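(* Let $B$ be a commutative complex $*$-algebra with a left action of a group $\Gamma$ preserving the involution, let $\gamma_1,\dots,\gamma_n\in\Gamma$, $\nabla=\mathrm{diag}(\gamma_1,\dots,\gamma_n)\in M_n(B\rtimes\Gamma)$, and let $F\in GL_n(B)$ be self-adjoint and $\nabla$-even, i.e. $F^*=F$ and $\nabla F\nabla^{-1}\in M_n(B)$. Let $A^B_{\mathrm u}(\nabla,F)$ be the free unitary dynamical quantum group with fundamental unitary matrix $u$. Then: (a) $F^{-1}$ is an intertwiner from $u$ to $S_n^2(u)$, i.e. $r_n(\nabla F^{-1}\nabla^{-1})u=S_n^2(u)s_n(F^{-1})$; (b) $K:=(\nabla F\nabla^{-1})^{\mathsf T}$ is an intertwiner from $\overline u$ to $S_n^2(\overline u)$, i.e. $\nabla^{-1}K\nabla\in M_n(B)$ and $r_n(\nabla^{-1}K\nabla)\overline u=S_n^2(\overline u)s_n(K)$; (c) $A^B_{\mathrm u}(\nabla,F)$ has an imaginary scaling character group $\theta=(\theta^{(k)})_{k\in\mathbb Z}$ such that $\theta^{(k)}_n(u)=\nabla F^{-k}$ and $\theta^{(k)}_n(\overline u)=(F^k)^{\mathsf T}\nabla^{-1}$ for all $k\in\mathbb Z$.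
   Context: All algebras and homomorphisms are unital over $\mathbb C$. $B$ is a commutative $*$-algebra on which the group $\Gamma$ acts from the left by $*$-automorphisms; $e\in\Gamma$ is the unit. A $(B,\Gamma)$-algebra is an algebra $A$ with a grading $A=\bigoplus_{\gamma,\gamma'\in\Gamma}A_{\gamma,\gamma'}$ (with $A_{\gamma,\gamma'}A_{\beta,\beta'}\subseteq A_{\gamma\beta,\gamma'\beta'}$) and homomorphisms $r,s\colon B\to A_{e,e}$ with commuting images such that $a\,r(b)=r(\gamma(b))a$ and $a\,s(b)=s(\gamma'(b))a$ for all $a\in A_{\gamma,\gamma'}$, $b\in B$. Morphisms are grading-preserving homomorphisms compatible with $r$ and $s$. A $(B,\Gamma)$-$*$-algebra is a $(B,\Gamma)$-algebra with an involution such that $(A_{\gamma,\gamma'})^*=A_{\gamma^{-1},\gamma'^{-1}}$, $r(b)^*=r(b^* )$, $s(b)^*=s(b^* )$; morphisms are required to preserve the involution. The crossed product $B\rtimes\Gamma$ is spanned by elements $b\gamma$ with $b\gamma\cdot b'\gamma'=b\gamma(b')\gamma\gamma'$ and $(b\gamma)^*=\gamma^{-1}b^*$; it is a $(B,\Gamma)$-$*$-algebra with $b\gamma$ in degree $(\gamma,\gamma)$ and $r(b)=s(b)=b$. $M_n(B)$ is viewed inside $M_n(B\rtimes\Gamma)$. $S^{B\rtimes\Gamma}$ denotes the anti-automorphism $b\gamma\mapsto\gamma^{-1}b$ of $B\rtimes\Gamma$. Fiber product: for $(B,\Gamma)$-algebras $A,C$ let $A\overset{\Gamma}{\otimes}C=\sum_{\gamma,\gamma',\gamma''}A_{\gamma,\gamma'}\otimes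 C_{\gamma',\gamma''}\subseteq A\otimes C$, and let $A\tilde\otimes C$ be its quotient by the ideal generated by $\{s_A(b)\otimes1-1\otimes r_C(b):b\in B\}$. It is a $(B,\Gamma)$-algebra with $A_{\gamma,\gamma'}\tilde\otimes C_{\gamma',\gamma''}$ in degree $(\gamma,\gamma'')$ and $r(b)=r_A(b)\tilde\otimes1$, $s(b)=1\tilde\otimes s_C(b)$; for $(B,\Gamma)$-$*$-algebras, $(a\tilde\otimes c)^*=a^*\tilde\otimes c^*$. It is functorial and associative, and $(B\rtimes\Gamma)\tilde\otimes A\cong A$ via $b\gamma\tilde\otimes a\mapsto r(b)a$, $A\tilde\otimes(B\rtimes\Gamma)\cong A$ via $a\tilde\otimes b\gamma\mapsto s(b)a$. $A^{\mathsf{co},\mathsf{op}}$ is the opposite algebra of $A$ with $(A^{\mathsf{co},\mathsf{op}})_{\gamma,\gamma'}=A_{\gamma'^{-1},\gamma^{-1}}$, $r_{A^{\mathsf{co},\mathsf{op}}}=s_A$, $s_{A^{\mathsf{co},\mathsf{op}}}=r_A$. A $(B,\Gamma)$-Hopf algebroid is a $(B,\Gamma)$-algebra $A$ with morphisms of $(B,\Gamma)$-algebras $\Delta\colon A\to A\tilde\otimes A$, $\epsilon\colon A\to B\rtimes\Gamma$, $S\colon A\to A^{\mathsf{co},\mathsf{op}}$ such that $(\Delta\tilde\otimes\mathrm{id})\Delta=(\mathrm{id}\tilde\otimes\Delta)\Delta$, $(\epsilon\tilde\otimes\mathrm{id})\Delta=\mathrm{id}=(\mathrm{id}\tilde\otimes\epsilon)\Delta$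 (using the isomorphisms above), and, writing $\Delta(a)=\sum a_{(1)}\tilde\otimes a_{(2)}$, $\sum S(a_{(1)})a_{(2)}=\check s(\epsilon(a))$ and $\sum a_{(1)}S(a_{(2)})=\hat r(\epsilon(a))$, where $\check s(\gamma b)=s(b)$, $\hat r(b\gamma)=r(b)$. It is a $(B,\Gamma)$-Hopf $*$-algebroid if moreover $A$ is a $(B,\Gamma)$-$*$-algebra and $\Delta,\epsilon$ are $*$-preserving. For a linear map $\phi$, $\phi_n$ denotes its entrywise extension to matrices; $X^{-\mathsf T}:=(X^{-1})^{\mathsf T}$, $\overline X:=(X_{ij}^* )_{i,j}$, $X^*=\overline X^{\mathsf T}$. The free unitary dynamical quantum group $A^B_{\mathrm u}(\nabla,F)$ is the universal $(B,\Gamma)$-$*$-algebra with a unitary $n\times n$-matrix $u$ such that $u_{ij}$ has degree $(\gamma_i,\gamma_j)$, $\overline u=u^{-\mathsf T}$ is invertible and $r_n(\nabla F\nabla^{-1})\overline u^{-\mathsf T}=us_n(F)$; it carries the unique $(B,\Gamma)$-Hopf $*$-algebroid structure with $\Delta(u_{ij})=\sum_ku_{ik}\tilde\otimes u_{kj}$, $\epsilon(u_{ij})=\delta_{i,j}\gamma_i$, $S(u_{ij})=(u^{-1})_{ij}$. A character group on a $(B,\Gamma)$-Hopf algebroid $(A,\Delta,\epsilon,S)$ is a family of morphisms of $(B,\Gamma)$-algebras $\theta^{(k)}\colon A\to B\rtimes\Gamma$, $k\in\mathbb Z$, with $(\theta^{(k)}\tilde\otimes\theta^{(l)})\circ\Delta=\theta^{(k+l)}$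 (identifying $(B\rtimes\Gamma)\tilde\otimes(B\rtimes\Gamma)\cong B\rtimes\Gamma$), $\theta^{(0)}=\epsilon$ and $\theta^{(k)}\circ S=S^{B\rtimes\Gamma}\circ\theta^{(-k)}$ for all $k,l$. It is scaling if $S^2=(\theta^{(1)}\tilde\otimes\mathrm{id}\tilde\otimes\theta^{(-1)})\circ\Delta^{(2)}$, where $\Delta^{(2)}=(\Delta\tilde\otimes\mathrm{id})\circ\Delta$ (identifying $(B\rtimes\Gamma)\tilde\otimes A\tilde\otimes(B\rtimes\Gamma)\cong A$). On a $(B,\Gamma)$-Hopf $*$-algebroid it is imaginary if $\theta^{(k)}\circ*=*\circ\theta^{(-k)}$ for all $k$. *)

(* Defs.v *)
From HB Require Import structures.
From mathcomp Require Import all_boot all_order all_algebra.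
From mathcomp Require Import finmap boolp reals complex monalg.
Set Implicit Arguments.
Unset Strict Implicit.
Unset Printing Implicit Defensive.
Import Order.TTheory GRing.Theory Num.Theory.
Local Open Scope ring_scope.
Local Open Scope quotient_scope.

(* A complex algebra is encoded as a ring with a central homomorphism
   [scal : K -> A], the scalar multiple of x by k being [scal k * x].  MathComp's
   algType is too narrow: it requires 1 != 0, but a fiber product may vanish. *)
HB.mixin Record isPzAlgebra (K : pzRingType) A of GRing.PzRing A := {
  scal : K -> A;
  scalD : forall k l, scal (k + l) = scal k + scal l;
  scalM : forall k l, scal (k * l) = scal k * scal l;
  scal1 : scal 1 = 1;
  scalC : forall k (x : A), scal k * x = x * scal k;
}.

#[short(type="pzAlgType")]
HB.structure Definition PzAlgebra (K : pzRingType) :=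
  {A of isPzAlgebra K A & GRing.PzRing A}.

#[short(type="comPzAlgType")]
HB.structure Definition ComPzAlgebra (K : pzRingType) :=
  {A of PzAlgebra K A & GRing.ComPzRing A}.

HB.mixin Record hasStar (K : numClosedFieldType) A of PzAlgebra K A := {
  star : A -> A;
  starD : forall x y : A, star (x + y) = star x + star y;
  starM : forall x y : A, star (x * y) = star y * star x;
  star_scal : forall k : K, star (scal k) = scal k^*;
  starK : involutive star;
}.

#[short(type="starAlgType")]
HB.structure Definition StarAlgebra (K : numClosedFieldType) :=
  {A of hasStar K A & PzAlgebra K A}.

#[short(type="comStarAlgType")]
HB.structure Definition ComStarAlgebra (K : numClosedFieldType) :=
  {A of hasStar K A & ComPzAlgebra K A}.

(* Linear and unital, because of the clause on [scal]. *)
Definition is_alghom (K : pzRingType) (A C : pzAlgType K) (f : A -> C) : Prop :=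
  [/\ {morph f : x y / x + y}, {morph f : x y / x * y}
    & forall k : K, f (scal k) = scal k].

Section AlgHomTheory.
Variables (K : pzRingType) (A C : pzAlgType K) (f : A -> C).
Hypothesis fP : is_alghom f.
Lemma alghomD x y : f (x + y) = f x + f y. Proof. by case: fP. Qed.
Lemma alghomM x y : f (x * y) = f x * f y. Proof. by case: fP. Qed.
Lemma alghom_scal k : f (scal k) = scal k. Proof. by case: fP. Qed.
Lemma alghom0 : f 0 = 0.
Proof. by apply: (addrI (f 0)); rewrite -alghomD !addr0. Qed.
Lemma alghom1 : f 1 = 1.
Proof. by rewrite -(scal1 (K:=K)) alghom_scal scal1. Qed.
Lemma alghom_sum I (r : seq I) (F : I -> A) :
  f (\sum_(i <- r) F i) = \sum_(i <- r) f (F i).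
Proof. exact: (big_morph f alghomD alghom0). Qed.
End AlgHomTheory.

Section StarTheory.
Variables (K : numClosedFieldType) (A : starAlgType K).
Lemma star0 : star (0 : A) = 0.
Proof. by apply: (addrI (star (0 : A))); rewrite -starD !addr0. Qed.
Lemma star1 : star (1 : A) = 1.
Proof. by rewrite -(scal1 (K:=K)) star_scal rmorph1. Qed.
Lemma star_sum I (r : seq I) (F : I -> A) :
  star (\sum_(i <- r) F i) = \sum_(i <- r) star (F i).
Proof. exact: (big_morph star (@starD K A) star0). Qed.
End StarTheory.

Record starAction (K : numClosedFieldType) (B : comStarAlgType K)
    (G : groupType) := StarAction {
  act :> G -> B -> B;
  act_hom : forall g, is_alghom (act g);
  act_star : forall g b, act g (star b) = star (act g b);
  act_1 : forall b, act 1%g b = b;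
  act_mul : forall g h b, act (g * h)%g b = act g (act h b);
}.

(* [deg g h x] means that x lies in A_(g,h); deg_span and deg_indep say that A
   is the direct sum of the A_(g,h). *)
HB.mixin Record isBGAlgebra (K : numClosedFieldType) (B : comStarAlgType K)
    (G : groupType) (act : starAction B G) A of PzAlgebra K A := {
  deg : G -> G -> A -> Prop;
  deg0 : forall g h, deg g h 0;
  degD : forall g h x y, deg g h x -> deg g h y -> deg g h (x + y);
  degZ : forall g h (k : K) x, deg g h x -> deg g h (scal k * x);
  deg_span : forall x : A, exists2 t : seq A,
    forall y, y \in t -> exists g h, deg g h y & x = \sum_(y <- t) y;
  deg_indep : forall (s : seq (G * G)) (f : G * G -> A), uniq s ->
    (forall d, d \in s -> deg d.1 d.2 (f d)) ->
    \sum_(d <- s) f d = 0 -> forall d, d \in s -> f d = 0;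
  degM : forall g h g' h' x y,
    deg g h x -> deg g' h' y -> deg (g * g')%g (h * h')%g (x * y);
  rmap : B -> A;
  smap : B -> A;
  rmap_hom : is_alghom rmap;
  smap_hom : is_alghom smap;
  rmap_deg : forall b, deg 1%g 1%g (rmap b);
  smap_deg : forall b, deg 1%g 1%g (smap b);
  rsmapC : forall b c, rmap b * smap c = smap c * rmap b;
  rmap_act : forall g h a b, deg g h a -> a * rmap b = rmap (act g b) * a;
  smap_act : forall g h a b, deg g h a -> a * smap b = smap (act h b) * a;
}.

#[short(type="bgAlgType")]
HB.structure Definition BGAlgebra (K : numClosedFieldType)
    (B : comStarAlgType K) (G : groupType) (act : starAction B G) :=
  {A of isBGAlgebra K B G act A & PzAlgebra K A}.

HB.mixin Record isBGStarAlgebra (K : numClosedFieldType)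
    (B : comStarAlgType K) (G : groupType) (act : starAction B G) A
    of isBGAlgebra K B G act A & hasStar K A & isPzAlgebra K A & GRing.PzRing A := {
  deg_star : forall g h (x : A), deg g h x -> deg g^-1%g h^-1%g (star x);
  rmap_star : forall b : B, star (rmap b : A) = rmap (star b);
  smap_star : forall b : B, star (smap b : A) = smap (star b);
}.

#[short(type="bgStarAlgType")]
HB.structure Definition BGStarAlgebra (K : numClosedFieldType)
    (B : comStarAlgType K) (G : groupType) (act : starAction B G) :=
  {A of isBGStarAlgebra K B G act A & isBGAlgebra K B G act A & StarAlgebra K A}.

Section Crossed.
Variables (K : numClosedFieldType) (B : comStarAlgType K) (G : groupType).
Variable act : starAction B G.

(* The free B-module on G: [<< b *g g >>] is the element written b g. *)
Definition crossed of starAction B G : Type := {malg B[G]}.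
HB.instance Definition _ := GRing.Zmodule.on (crossed act).

Definition mono (g : G) (b : B) : crossed act := << b *g g >>.

(* Additive extension of b g |-> f g b. *)
Definition crext (V : zmodType) (f : G -> B -> V) (x : crossed act) : V :=
  \sum_(g <- (msupp x : {fset G})) f g (mcoeff g x).

Lemma monoD g b c : mono g (b + c) = mono g b + mono g c.
Proof. exact: monalgUD. Qed.
Lemma mono0 g : mono g 0 = 0.
Proof. exact: monalgU0. Qed.

Section Crext.
Variables (V : zmodType) (f : G -> B -> V).
Hypothesis fD : forall g b c, f g (b + c) = f g b + f g c.

Let f0 g : f g 0 = 0.
Proof. by apply: (addrI (f g 0)); rewrite -fD !addr0. Qed.

Lemma crextEw (d : {fset G}) (x : crossed act) : (msupp x `<=` d)%fset ->
  crext f x = \sum_(g <- d) f g (mcoeff g x).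
Proof.
move=> le; rewrite /crext (big_fset_incl _ le) // => g _ /mcoeff_outdom ->.
exact: f0.
Qed.

Lemma crext_mono g b : crext f (mono g b) = f g b.
Proof.
rewrite (@crextEw [fset g]%fset) ?msuppU_le //.
by rewrite big_seq_fset1 mcoeffUU.
Qed.

Lemma crextD x y : crext f (x + y) = crext f x + crext f y.
Proof.
rewrite (@crextEw (msupp x `|` msupp y)%fset (x + y)) ?msuppD_le //.
rewrite (@crextEw (msupp x `|` msupp y)%fset x) ?fsubsetUl //.
rewrite (@crextEw (msupp x `|` msupp y)%fset y) ?fsubsetUr //.
by rewrite -big_split; apply: eq_bigr => g _; rewrite mcoeffD fD.
Qed.

Lemma crext0 : crext f 0 = 0.
Proof. by apply: (addrI (crext f 0)); rewrite -crextD !addr0. Qed.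
End Crext.

Lemma crossed_ind (P : crossed act -> Prop) :
  (forall g b, P (mono g b)) -> (forall x y, P x -> P y -> P (x + y)) ->
  forall x, P x.
Proof.
move=> Pm PD x; rewrite (monalgE x : x = _).
have P0 : P 0 by rewrite -(mono0 1%g); apply: Pm.
by apply: (big_ind P) => // g _; apply: Pm.
Qed.

Definition crmul (x y : crossed act) : crossed act :=
  crext (fun g b => crext (fun h c => mono (g * h)%g (b * act g c)) y) x.

Definition crscal (k : K) : crossed act := mono 1%g (scal k).

Definition crstar : crossed act -> crossed act :=
  crext (fun g b => mono g^-1%g (act g^-1%g (star b))).

Let actD g := alghomD (act_hom act g).
Let act0 g := alghom0 (act_hom act g).
Let actM g := alghomM (act_hom act g).

Let m1D g b h c c' : mono (g * h)%g (b * act g (c + c'))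
  = mono (g * h)%g (b * act g c) + mono (g * h)%g (b * act g c').
Proof. by rewrite actD mulrDr monoD. Qed.

Let m2D g b b' y :
  crext (fun h c => mono (g * h)%g ((b + b') * act g c)) y
  = crext (fun h c => mono (g * h)%g (b * act g c)) y
    + crext (fun h c => mono (g * h)%g (b' * act g c)) y.
Proof.
rewrite /crext -big_split; apply: eq_bigr => h _.
by rewrite mulrDl monoD.
Qed.

Lemma crmulDl : left_distributive crmul +%R.
Proof. by move=> x y z; rewrite /crmul crextD // => g b c; apply: m2D. Qed.

Lemma crmulDr : right_distributive crmul +%R.
Proof.
move=> x y z; rewrite [LHS]/crmul [X in X = _]/crext.
rewrite [X in _ = X + _]/crmul [X in _ = X + _]/crext.
rewrite [X in _ = _ + X]/crmul [X in _ = _ + X]/crext.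
rewrite -big_split; apply: eq_bigr => g _ /=.
by rewrite crextD // => h c c'; apply: m1D.
Qed.

Lemma crmulE g b h c :
  crmul (mono g b) (mono h c) = mono (g * h)%g (b * act g c).
Proof.
rewrite /crmul crext_mono => [|g' b' b'']; last exact: m2D.
by rewrite crext_mono // => h' c' c''; apply: m1D.
Qed.

Lemma crmulA : associative crmul.
Proof.
move=> x y z; elim/crossed_ind: x => [g b|x x' IH IH']; last first.
  by rewrite !crmulDl IH IH'.
elim/crossed_ind: y => [h c|y y' IH IH']; last first.
  by rewrite !(crmulDl, crmulDr) IH IH'.
elim/crossed_ind: z => [l d|z z' IH IH']; last by rewrite !crmulDr IH IH'.
by rewrite !crmulE actM act_mul !mulrA mulgA.
Qed.

Lemma crmul1 : left_id (mono 1%g 1) crmul.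
Proof.
elim/crossed_ind=> [g b|x y IH IH']; last by rewrite crmulDr IH IH'.
by rewrite crmulE mul1r act_1 mul1g.
Qed.

Lemma crmulr1 : right_id (mono 1%g 1) crmul.
Proof.
elim/crossed_ind=> [g b|x y IH IH']; last by rewrite crmulDl IH IH'.
by rewrite crmulE (alghom1 (act_hom act g)) mulr1 mulg1.
Qed.

HB.instance Definition _ := GRing.Zmodule_isPzRing.Build (crossed act)
  crmulA crmul1 crmulr1 crmulDl crmulDr.

Lemma monoM g b h c : mono g b * mono h c = mono (g * h)%g (b * act g c).
Proof. exact: crmulE. Qed.

Lemma crscalD k l : crscal (k + l) = crscal k + crscal l.
Proof. by rewrite /crscal scalD monoD. Qed.
Lemma crscalM k l : crscal (k * l) = crscal k * crscal l.
Proof. by rewrite /crscal monoM scalM mulg1 act_1. Qed.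
Lemma crscal1 : crscal 1 = 1.
Proof. by rewrite /crscal scal1. Qed.
Lemma crscalC k (x : crossed act) : crscal k * x = x * crscal k.
Proof.
elim/crossed_ind: x => [g b|x y IH IH']; last by rewrite mulrDr mulrDl IH IH'.
by rewrite /crscal !monoM act_1 mul1g mulg1 (alghom_scal (act_hom act g)) mulrC.
Qed.

HB.instance Definition _ :=
  isPzAlgebra.Build K (crossed act) crscalD crscalM crscal1 crscalC.

Let starf_D g b c : mono g^-1%g (act g^-1%g (star (b + c)))
  = mono g^-1%g (act g^-1%g (star b)) + mono g^-1%g (act g^-1%g (star c)).
Proof. by rewrite starD actD monoD. Qed.

Lemma crstarE g b : crstar (mono g b) = mono g^-1%g (act g^-1%g (star b)).
Proof. exact: (crext_mono starf_D). Qed.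
Lemma crstarD (x y : crossed act) : crstar (x + y) = crstar x + crstar y.
Proof. exact: (crextD starf_D). Qed.
Lemma crstarM (x y : crossed act) : crstar (x * y) = crstar y * crstar x.
Proof.
elim/crossed_ind: x => [g b|x x' IH IH']; last first.
  by rewrite mulrDl !crstarD mulrDr IH IH'.
elim/crossed_ind: y => [h c|y y' IH IH']; last first.
  by rewrite mulrDr !crstarD mulrDl IH IH'.
rewrite monoM !crstarE monoM starM invgM actM -act_star !act_mul.
by rewrite -(act_mul act g^-1%g g) mulVg act_1.
Qed.
Lemma crstar_scal k : crstar (scal k) = scal k^*.
Proof. by rewrite crstarE star_scal invg1 act_1. Qed.
Lemma crstarK : involutive crstar.
Proof.
elim/crossed_ind=> [g b|x y IH IH']; last by rewrite !crstarD IH IH'.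
by rewrite !crstarE -act_star starK -act_mul invgK mulgV act_1.
Qed.

HB.instance Definition _ := hasStar.Build K (crossed act)
  crstarD crstarM crstar_scal crstarK.

Definition crdeg (g h : G) (x : crossed act) : Prop :=
  exists b, x = if g == h then mono g b else 0.

Definition iota (b : B) : crossed act := mono 1%g b.

Lemma crdeg0 g h : crdeg g h 0.
Proof. by exists 0; rewrite mono0 if_same. Qed.
Lemma crdegD g h x y : crdeg g h x -> crdeg g h y -> crdeg g h (x + y).
Proof.
move=> [b ->] [c ->]; exists (b + c).
by case: eqP; rewrite ?monoD ?addr0.
Qed.
Lemma crdegZ g h (k : K) x : crdeg g h x -> crdeg g h (scal k * x).
Proof.
move=> [b ->]; exists (scal k * b).
by case: eqP; rewrite ?mulr0 // monoM mul1g act_1.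
Qed.
Lemma crdeg_span (x : crossed act) : exists2 t : seq (crossed act),
  forall y, y \in t -> exists g h, crdeg g h y & x = \sum_(y <- t) y.
Proof.
elim/crossed_ind: x => [g b|x y [t th ->] [t' th' ->]].
  exists [:: mono g b] => [y|]; last by rewrite big_seq1.
  by rewrite inE => /eqP ->; exists g, g, b; rewrite eqxx.
exists (t ++ t') => [z|]; last by rewrite big_cat.
by rewrite mem_cat => /orP[/th|/th'].
Qed.
Lemma crdeg_indep (s : seq (G * G)) (f : G * G -> crossed act) : uniq s ->
    (forall d, d \in s -> crdeg d.1 d.2 (f d)) ->
    \sum_(d <- s) f d = 0 -> forall d, d \in s -> f d = 0.
Proof.
move=> us fd fs d ds; have [b def_b] := fd _ ds.
rewrite def_b; case: eqP => // d12; have := congr1 (mcoeff d.1) fs.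
rewrite raddf_sum raddf0 (bigD1_seq d) //= big_seq_cond big1.
  by rewrite addr0 def_b d12 eqxx mcoeffUU => ->; rewrite mono0.
move=> d' /andP[/fd[c ->] nd]; case: eqP => [e|_]; last exact: mcoeff0.
rewrite /= mcoeffU; case: eqP => // e'; case/eqP: nd.
by case: d d' d12 e e' {def_b ds} => [d1 d2] [d1' d2'] /= <- <- ->.
Qed.
Lemma crdegM g h g' h' x y :
  crdeg g h x -> crdeg g' h' y -> crdeg (g * g')%g (h * h')%g (x * y).
Proof.
move=> [b ->] [c ->]; case: (g =P h) => [<-|_]; last first.
  by rewrite mul0r; apply: crdeg0.
case: (g' =P h') => [<-|_]; last by rewrite mulr0; apply: crdeg0.
by rewrite monoM; eexists; rewrite eqxx.
Qed.
Lemma iota_hom : is_alghom iota.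
Proof.
split=> // [x y|x y]; first exact: monoD.
by rewrite /iota monoM mulg1 act_1.
Qed.
Lemma iota_deg b : crdeg 1%g 1%g (iota b).
Proof. by exists b; rewrite eqxx. Qed.
Lemma iotaC b c : iota b * iota c = iota c * iota b.
Proof. by rewrite -!(alghomM iota_hom) mulrC. Qed.
Lemma iota_act g h a b : crdeg g h a -> a * iota b = iota (act g b) * a.
Proof.
move=> [c ->]; case: eqP => _; last by rewrite mulr0 mul0r.
by rewrite !monoM mulg1 mul1g act_1 mulrC.
Qed.
Lemma iota_act' g h a b : crdeg g h a -> a * iota b = iota (act h b) * a.
Proof.
move=> da; have [c def_a] := da; move: (iota_act b da).
by case: (g =P h) def_a => [-> //|_ ->]; rewrite !mulr0 !mul0r.
Qed.

HB.instance Definition _ := isBGAlgebra.Build K B G act (crossed act)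
  crdeg0 crdegD crdegZ crdeg_span crdeg_indep crdegM iota_hom iota_hom
  iota_deg iota_deg iotaC iota_act iota_act'.

Lemma crdeg_star g h (x : crossed act) :
  crdeg g h x -> crdeg g^-1%g h^-1%g (star x).
Proof.
move=> [b ->]; rewrite /crdeg (inj_eq invg_inj).
case: eqP => _; last by exists 0; apply: (@star0 K (crossed act)).
by eexists; apply: crstarE.
Qed.
Lemma iota_star b : star (iota b) = iota (star b).
Proof. by rewrite [LHS]crstarE invg1 act_1. Qed.

HB.instance Definition _ := isBGStarAlgebra.Build K B G act (crossed act)
  crdeg_star iota_star iota_star.

(* b g |-> g^-1 b. *)
Definition crantip : crossed act -> crossed act :=
  crext (fun g b => mono g^-1%g (act g^-1%g b)).

(* The component in B, meaningful on elements of B. *)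
Definition bpart (x : crossed act) : B := mcoeff 1%g x.

End Crossed.

Section Coop.
Variables (K : numClosedFieldType) (B : comStarAlgType K) (G : groupType).
Variables (act : starAction B G) (A : bgAlgType act).

(* A^(co,op): the opposite ring, with r and s exchanged. *)
Definition coop : Type := (A : Type)^c.
HB.instance Definition _ := GRing.PzRing.on coop.

Definition coscal (k : K) : coop := (scal k : A).
Lemma coscalD k l : coscal (k + l) = coscal k + coscal l.
Proof. exact: scalD. Qed.
Lemma coscalM k l : coscal (k * l) = coscal k * coscal l.
Proof. by rewrite mulrC; apply: (@scalM K A). Qed.
Lemma coscal1 : coscal 1 = 1. Proof. exact: scal1. Qed.
Lemma coscalC k (x : coop) : coscal k * x = x * coscal k.
Proof. exact/esym/(@scalC K A). Qed.
HB.instance Definition _ :=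
  isPzAlgebra.Build K coop coscalD coscalM coscal1 coscalC.

Definition codeg (g h : G) (x : coop) : Prop := deg h^-1%g g^-1%g (x : A).
Definition cor (b : B) : coop := (smap b : A).
Definition cos (b : B) : coop := (rmap b : A).

Lemma codeg0 g h : codeg g h 0. Proof. exact: deg0. Qed.
Lemma codegD g h x y : codeg g h x -> codeg g h y -> codeg g h (x + y).
Proof. exact: degD. Qed.
Lemma codegZ g h (k : K) x : codeg g h x -> codeg g h (scal k * x).
Proof. by move=> d; rewrite coscalC; apply: (@degZ K B G act A). Qed.
Lemma codeg_span (x : coop) : exists2 t : seq coop,
  forall y, y \in t -> exists g h, codeg g h y & x = \sum_(y <- t) y.
Proof.
have [t th ->] := deg_span (x : A); exists t => // y /th [g [h d]].
by exists h^-1%g, g^-1%g; rewrite /codeg !invgK.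
Qed.
Lemma codeg_indep (s : seq (G * G)) (f : G * G -> coop) : uniq s ->
    (forall d, d \in s -> codeg d.1 d.2 (f d)) ->
    \sum_(d <- s) f d = 0 -> forall d, d \in s -> f d = 0.
Proof.
move=> us fd fs d ds.
pose i (d : G * G) := (d.2^-1, d.1^-1)%g.
have iK : involutive i by case=> g h; rewrite /i /= !invgK.
have fs' : \sum_(d <- map i s) f (i d) = 0 :> A.
  by rewrite big_map -[RHS]fs; apply: eq_bigr => e _; rewrite iK.
rewrite -(iK d); apply: (@deg_indep K B G act A (map i s) (f \o i) _ _ fs').
- by rewrite (map_inj_uniq (can_inj iK)).
- by move=> _ /mapP[e es ->] /=; rewrite iK; apply: fd.
- exact: map_f.
Qed.
Lemma codegM g h g' h' x y :
  codeg g h x -> codeg g' h' y -> codeg (g * g')%g (h * h')%g (x * y).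
Proof. by move=> dx dy; rewrite /codeg !invgM; apply: (@degM K B G act A _ _ _ _ _ _ dy dx). Qed.
Lemma cor_hom : is_alghom cor.
Proof.
split=> [x y|x y|k]; [exact: (alghomD smap_hom)| |exact: (alghom_scal smap_hom)].
by rewrite mulrC; apply: (alghomM (@smap_hom K B G act A)).
Qed.
Lemma cos_hom : is_alghom cos.
Proof.
split=> [x y|x y|k]; [exact: (alghomD rmap_hom)| |exact: (alghom_scal rmap_hom)].
by rewrite mulrC; apply: (alghomM (@rmap_hom K B G act A)).
Qed.
Lemma cor_deg b : codeg 1%g 1%g (cor b).
Proof. by rewrite /codeg invg1; apply: smap_deg. Qed.
Lemma cos_deg b : codeg 1%g 1%g (cos b).
Proof. by rewrite /codeg invg1; apply: rmap_deg. Qed.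
Lemma corsC b c : cor b * cos c = cos c * cor b.
Proof. exact: (@rsmapC K B G act A). Qed.
Lemma cor_act g h a b : codeg g h a -> a * cor b = cor (act g b) * a.
Proof.
move=> d; have := @smap_act K B G act A _ _ _ (act g b) d.
by rewrite -act_mul mulVg act_1 => e; apply/esym.
Qed.
Lemma cos_act g h a b : codeg g h a -> a * cos b = cos (act h b) * a.
Proof.
move=> d; have := @rmap_act K B G act A _ _ _ (act h b) d.
by rewrite -act_mul mulVg act_1 => e; apply/esym.
Qed.
HB.instance Definition _ := isBGAlgebra.Build K B G act coop
  codeg0 codegD codegZ codeg_span codeg_indep codegM cor_hom cos_hom
  cor_deg cos_deg corsC cor_act cos_act.
End Coop.
Arguments coop {K B G act} A.

Section Mor.
Variables (K : numClosedFieldType) (B : comStarAlgType K) (G : groupType).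
Variable act : starAction B G.

Record bgMor (A C : bgAlgType act) := BGMor {
  mor :> A -> C;
  mor_hom : is_alghom mor;
  mor_deg : forall g h x, deg g h x -> deg g h (mor x);
  mor_r : forall b, mor (rmap b) = rmap b;
  mor_s : forall b, mor (smap b) = smap b;
}.

Definition star_preserving (A C : bgStarAlgType act) (f : bgMor A C) : Prop :=
  forall a, f (star a) = star (f a).

Lemma idmor_hom (A : bgAlgType act) : is_alghom (@id A). Proof. by []. Qed.
Definition idmor (A : bgAlgType act) : bgMor A A :=
  BGMor (idmor_hom A) (fun _ _ _ d => d) (fun=> erefl) (fun=> erefl).
End Mor.
Arguments idmor {K B G act} A.

Section DegProj.
Variables (K : numClosedFieldType) (B : comStarAlgType K) (G : groupType).
Variables (act : starAction B G) (A : bgAlgType act) (sel : pred (G * G)).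

Let hom (t : seq (G * G * A)) := forall q, q \in t -> deg q.1.1 q.1.2 q.2.

Let group (P : pred (G * G)) (t : seq (G * G * A)) :
  \sum_(q <- t | P q.1) q.2 = \sum_(d <- undup (map fst t) | P d)
                                \sum_(q <- t | q.1 == d) q.2.
Proof.
rewrite (exchange_big_dep (fun q => P q.1)) /=; last first.
  by move=> d q Pd /eqP ->.
rewrite big_seq_cond [RHS]big_seq_cond; apply: eq_bigr => q /andP[qt Pq].
have qs : q.1 \in undup (map fst t) by rewrite mem_undup map_f.
rewrite [RHS]big_mkcond (bigD1_seq q.1) ?undup_uniq //= Pq eqxx /=.
by rewrite big1 ?addr0 // => d; rewrite eq_sym andbC => /negPf ->.
Qed.

Let sel0 t : hom t -> \sum_(q <- t) q.2 = 0 -> \sum_(q <- t | sel q.1) q.2 = 0.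
Proof.
move=> ht t0; rewrite group big_seq_cond big1 // => d /andP[ds _].
apply: (@deg_indep K B G act A (undup (map fst t))
          (fun d => \sum_(q <- t | q.1 == d) q.2)) ds.
- exact: undup_uniq.
- move=> e _; rewrite big_seq_cond.
  apply: (big_ind (deg e.1 e.2)); [exact: deg0|exact: degD|].
  by move=> q /andP[/ht dq /eqP <-].
- by rewrite -[RHS]t0 -(group predT).
Qed.

Let total x : exists y, exists t, [/\ hom t, x = \sum_(q <- t) q.2
  & y = \sum_(q <- t | sel q.1) q.2].
Proof.
suff [t [ht ->]] : exists t, hom t /\ x = \sum_(q <- t) q.2.
  by eexists; exists t.
have [t dt ->] := deg_span x; elim: t dt => [|y t IH] dt.
  by exists [::]; split; rewrite ?big_nil.
rewrite big_cons.
have [|t' [ht' ->]] := IH; first by move=> z zt; apply: dt; rewrite inE zt orbT.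
have [g [h d]] := dt y (mem_head _ _).
exists (((g, h), y) :: t'); split=> [q|].
  by rewrite inE => /orP[/eqP ->//|/ht'].
by rewrite big_cons.
Qed.

Let p x := sval (cid (total x)).

Let pE t : hom t -> p (\sum_(q <- t) q.2) = \sum_(q <- t | sel q.1) q.2.
Proof.
move=> ht; rewrite /p; case: cid => y /= [t' [ht' e ->]].
apply/eqP; rewrite eq_sym -subr_eq0; apply/eqP.
pose n (q : G * G * A) := (q.1, - q.2).
have -> : \sum_(q <- t | sel q.1) q.2 - \sum_(q <- t' | sel q.1) q.2
    = \sum_(q <- t ++ map n t' | sel q.1) q.2.
  by rewrite big_cat big_map /= sumrN.
apply: sel0; last by rewrite big_cat big_map /= sumrN e subrr.
move=> q; rewrite mem_cat => /orP[/ht//|/mapP[q' /ht' d ->]] /=.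
have -> : - q'.2 = scal (-1 : K) * q'.2.
  apply/eqP; rewrite eq_sym -subr_eq0 opprK -{2}[q'.2]mul1r -(scal1 (K:=K)).
  rewrite -mulrDl -scalD addNr; apply/eqP.
  have -> : scal (0 : K) = 0 :> A.
    by apply: (addrI (scal (0 : K))); rewrite -scalD !addr0.
  by rewrite mul0r.
exact: degZ.
Qed.

Lemma degproj : exists p : A -> A,
  [/\ {morph p : x y / x + y}, forall (k : K) x, p (scal k * x) = scal k * p x
    & forall g h x, deg g h x -> p x = if sel (g, h) then x else 0].
Proof.
exists p; split=> [x y|k x|g h x d].
- have [_ [t [ht -> _]]] := total x; have [_ [t' [ht' -> _]]] := total y.
  rewrite !pE // -!big_cat pE // => q.
  by rewrite mem_cat => /orP[/ht|/ht'].
- have [_ [t [ht -> _]]] := total x; rewrite pE // !mulr_sumr.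
  have := @pE [seq (q.1, scal k * q.2) | q <- t].
  rewrite !big_map; apply=> _ /mapP[q /ht d ->]; exact: degZ.
- have := @pE [:: ((g, h), x)]; rewrite big_seq1 /= => -> //.
    by rewrite big_mkcond big_seq1.
  by move=> q; rewrite inE => /eqP ->.
Qed.
End DegProj.

Section Fiber.
Variables (K : numClosedFieldType) (B : comStarAlgType K) (G : groupType).
Variables (act : starAction B G) (A C : bgAlgType act).

(* Elements of the tensor product A (x) C are formal sums of pairs (a, c),
   written as sequences; those of its subalgebra
   \sum_(g,h,k) A_(g,h) (x) C_(h,k) are the sums of pairs satisfying [fib]. *)
Definition fib (p : A * C) : bool :=
  `[< exists g h k, deg g h p.1 /\ deg h k p.2 >].

Definition pmul (p q : A * C) : A * C := (p.1 * q.1, p.2 * q.2).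

(* All clauses but the last present A (x) C; the last one divides out the ideal
   of the subalgebra generated by the s(b) (x) 1 - 1 (x) r(b). *)
Inductive feq : seq (A * C) -> seq (A * C) -> Prop :=
| feq_sym w w' : feq w w' -> feq w' w
| feq_trans w1 w2 w3 : feq w1 w2 -> feq w2 w3 -> feq w1 w3
| feq_perm w w' : perm_eq w w' -> feq w w'
| feq_cat w1 w1' w2 w2' :
    feq w1 w1' -> feq w2 w2' -> feq (w1 ++ w2) (w1' ++ w2')
| feq_0 c : feq [:: (0, c)] [::]
| feq_Dl a a' c : feq [:: (a + a', c)] [:: (a, c); (a', c)]
| feq_Dr a c c' : feq [:: (a, c + c')] [:: (a, c); (a, c')]
| feq_scal k a c : feq [:: (scal k * a, c)] [:: (a, scal k * c)]
| feq_ideal p q b : fib p -> fib q ->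
    feq [:: (p.1 * smap b * q.1, p.2 * q.2)]
        [:: (p.1 * q.1, p.2 * rmap b * q.2)].

Lemma feq_refl w : feq w w. Proof. exact: feq_perm. Qed.
Hint Resolve feq_refl : core.

Definition fibsum := {w : seq (A * C) | all fib w}.
Definition fibsum_eq (w w' : fibsum) : bool := `[< feq (val w) (val w') >].

Lemma fibsum_eq_refl : reflexive fibsum_eq.
Proof. by move=> w; apply/asboolP. Qed.
Lemma fibsum_eq_sym : symmetric fibsum_eq.
Proof. by move=> w w'; apply/asboolP/asboolP; apply: feq_sym. Qed.
Lemma fibsum_eq_trans : transitive fibsum_eq.
Proof. by move=> w w' w'' /asboolP h /asboolP /(feq_trans h) ?; apply/asboolP. Qed.
Canonical fibsum_equiv :=
  EquivRel fibsum_eq fibsum_eq_refl fibsum_eq_sym fibsum_eq_trans.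

Definition fiber : Type := {eq_quot fibsum_equiv}.
HB.instance Definition _ := Choice.on fiber.

Definition fcls0 (w : fibsum) : fiber := \pi_{eq_quot fibsum_equiv} w.

(* The class of a formal sum, and 0 if a pair violates [fib]. *)
Definition fcls (w : seq (A * C)) : fiber :=
  fcls0 (insubd (exist _ [::] isT : fibsum) w).

Definition ftens (a : A) (c : C) : fiber := fcls [:: (a, c)].

Definition frep (x : fiber) : seq (A * C) :=
  val (repr (x : {eq_quot fibsum_equiv})).

Lemma frep_fib x : all fib (frep x).
Proof. exact: (valP (repr (x : {eq_quot fibsum_equiv}))). Qed.

Lemma frepK x : fcls (frep x) = x.
Proof.
rewrite /fcls /fcls0; have -> : insubd (exist _ [::] isT : fibsum) (frep x)
  = repr (x : {eq_quot fibsum_equiv}) by exact: valKd.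
exact: reprK.
Qed.

Lemma fclsP w w' : all fib w -> all fib w' -> (fcls w = fcls w') <-> feq w w'.
Proof.
move=> hw hw'; rewrite /fcls /fcls0; split=> [/eqmodP /asboolP|h].
  by rewrite !val_insubd hw hw'.
by apply/eqmodP/asboolP; rewrite !val_insubd hw hw'.
Qed.

Lemma frep_fcls w : all fib w -> feq (frep (fcls w)) w.
Proof. by move=> hw; apply/fclsP => //; rewrite ?frep_fib ?frepK. Qed.

Lemma fiber_ind (P : fiber -> Prop) :
  (forall w, all fib w -> P (fcls w)) -> forall x, P x.
Proof. by move=> h x; rewrite -[x]frepK; apply/h/frep_fib. Qed.

Lemma feq_0r a : feq [:: (a, 0)] [::].
Proof.
have s0 (D : bgAlgType act) : scal (0 : K) = 0 :> D.
  by apply: (addrI (scal (0 : K))); rewrite -scalD !addr0.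
apply: feq_trans (feq_0 0); apply: feq_sym.
by have := feq_scal 0 a 0; rewrite !s0 !mul0r.
Qed.

Lemma feq_Nl a c : feq ((- a, c) :: [:: (a, c)]) [::].
Proof. by apply: feq_trans (feq_0 c); apply: feq_sym; rewrite -(addNr a); apply: feq_Dl. Qed.

Lemma feq_cons p w w' : feq w w' -> feq (p :: w) (p :: w').
Proof. by move=> h; rewrite -(cat1s p w) -(cat1s p w'); apply: feq_cat. Qed.

Definition wopp : seq (A * C) -> seq (A * C) := map (fun p => (- p.1, p.2)).
Definition wmul (w w' : seq (A * C)) := [seq pmul p q | p <- w, q <- w'].

Lemma fibM p q : fib p -> fib q -> fib (pmul p q).
Proof.
move=> /asboolP[g [h [k [d1 d2]]]] /asboolP[g' [h' [k' [d1' d2']]]].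
by apply/asboolP; exists (g * g')%g, (h * h')%g, (k * k')%g; split;
  [exact: degM d1 d1'|exact: degM d2 d2'].
Qed.

Lemma degN (D : bgAlgType act) g h (x : D) : deg g h x -> deg g h (- x).
Proof.
suff -> : - x = scal (-1 : K) * x by apply: degZ.
apply/eqP; rewrite eq_sym -subr_eq0 opprK -{2}[x]mul1r -(scal1 (K:=K)).
rewrite -mulrDl -scalD addNr; apply/eqP.
have -> : scal (0 : K) = 0 :> D.
  by apply: (addrI (scal (0 : K))); rewrite -scalD !addr0.
by rewrite mul0r.
Qed.

Lemma fib_opp w : all fib w -> all fib (wopp w).
Proof.
move=> /allP hw; apply/allP => _ /mapP[p /hw /asboolP[g [h [k [d d']]]] ->].
by apply/asboolP; exists g, h, k; split=> //; apply: degN.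
Qed.

Lemma fib_mul w w' : all fib w -> all fib w' -> all fib (wmul w w').
Proof.
move=> /allP hw /allP hw'; apply/allP => _ /allpairsP[[p q] [/hw hp /hw' hq ->]].
exact: fibM.
Qed.

Lemma feq_lmul p w w' : fib p -> feq w w' ->
  feq (map (pmul p) w) (map (pmul p) w').
Proof.
move=> fp; elim=> {w w'}.
- by move=> w w' _ h; apply: feq_sym.
- by move=> w1 w2 w3 _ h _ h'; apply: feq_trans h h'.
- by move=> w w' h; apply: feq_perm; apply: perm_map.
- by move=> w1 w1' w2 w2' _ h _ h'; rewrite !map_cat; apply: feq_cat.
- by move=> c; rewrite /= /pmul mulr0; apply: feq_0.
- by move=> a a' c; rewrite /= /pmul mulrDr; apply: feq_Dl.
- by move=> a c c'; rewrite /= /pmul mulrDr; apply: feq_Dr.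
- move=> k a c; rewrite /= /pmul /=.
  by rewrite !mulrA -!(scalC k) -!mulrA; apply: feq_scal.
- move=> q r b fq fr; rewrite /= /pmul /= !mulrA.
  exact: (feq_ideal b (fibM fp fq) fr).
Qed.

Lemma feq_rmul p w w' : fib p -> feq w w' ->
  feq (map (pmul^~ p) w) (map (pmul^~ p) w').
Proof.
move=> fp; elim=> {w w'}.
- by move=> w w' _ h; apply: feq_sym.
- by move=> w1 w2 w3 _ h _ h'; apply: feq_trans h h'.
- by move=> w w' h; apply: feq_perm; apply: perm_map.
- by move=> w1 w1' w2 w2' _ h _ h'; rewrite !map_cat; apply: feq_cat.
- by move=> c; rewrite /= /pmul mul0r; apply: feq_0.
- by move=> a a' c; rewrite /= /pmul mulrDl; apply: feq_Dl.
- by move=> a c c'; rewrite /= /pmul mulrDl; apply: feq_Dr.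
- by move=> k a c; rewrite /= /pmul /= -!mulrA; apply: feq_scal.
- move=> q r b fq fr; rewrite /= /pmul /= -!mulrA.
  have := feq_ideal b fq (fibM fr fp); rewrite /= -!mulrA; exact.
Qed.

Lemma feq_wmull v w w' : all fib v -> feq w w' -> feq (wmul v w) (wmul v w').
Proof.
elim: v => [|p v IH] //= /andP[fp fv] h.
by rewrite /wmul !allpairs_cons; apply: feq_cat; [apply: feq_lmul|apply: IH].
Qed.

Lemma feq_wmulr v w w' : all fib v -> feq w w' -> feq (wmul w v) (wmul w' v).
Proof.
elim: v => [|p v IH] fv h; first by rewrite /wmul !allpairs0r.
move: fv => /= /andP[fp fv].
have e u : perm_eq (wmul u (p :: v)) (map (pmul^~ p) u ++ wmul u v).
  by rewrite /wmul perm_allpairs_consr.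
apply: feq_trans (feq_perm (e w)) _; apply: feq_sym.
apply: feq_trans (feq_perm (e w')) _; apply: feq_sym.
by apply: feq_cat; [apply: feq_rmul|apply: IH].
Qed.

Definition fadd (x y : fiber) : fiber := fcls (frep x ++ frep y).
Definition fopp (x : fiber) : fiber := fcls (wopp (frep x)).
Definition fmul (x y : fiber) : fiber := fcls (wmul (frep x) (frep y)).

Lemma faddE w w' : all fib w -> all fib w' ->
  fadd (fcls w) (fcls w') = fcls (w ++ w').
Proof.
move=> hw hw'; apply/fclsP; rewrite ?all_cat ?frep_fib ?hw //.
by apply: feq_cat; apply: frep_fcls.
Qed.

Lemma feq_opp w w' : feq w w' -> feq (wopp w) (wopp w').
Proof.
elim=> {w w'}.
- by move=> w w' _ h; apply: feq_sym.
- by move=> w1 w2 w3 _ h _ h'; apply: feq_trans h h'.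
- by move=> w w' h; apply: feq_perm; apply: perm_map.
- by move=> w1 w1' w2 w2' _ h _ h'; rewrite /wopp !map_cat; apply: feq_cat.
- by move=> c; rewrite /= oppr0; apply: feq_0.
- by move=> a a' c; rewrite /= opprD; apply: feq_Dl.
- by move=> a c c'; apply: feq_Dr.
- by move=> k a c; rewrite /= -mulrN; apply: feq_scal.
- move=> p q b /asboolP[g [h [k [d d']]]] fq; rewrite /= -!mulNr.
  apply: (@feq_ideal (- p.1, p.2) q b _ fq).
  by apply/asboolP; exists g, h, k; split=> //; apply: degN.
Qed.

Lemma foppE w : all fib w -> fopp (fcls w) = fcls (wopp w).
Proof.
move=> hw; apply/fclsP; rewrite ?fib_opp ?frep_fib //.
by apply: feq_opp; apply: frep_fcls.
Qed.

Lemma fmulE w w' : all fib w -> all fib w' ->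
  fmul (fcls w) (fcls w') = fcls (wmul w w').
Proof.
move=> hw hw'; apply/fclsP; rewrite ?fib_mul ?frep_fib //.
apply: (@feq_trans _ (wmul (frep (fcls w)) w')).
  by apply: feq_wmull; [apply: frep_fib|apply: frep_fcls].
by apply: feq_wmulr => //; apply: frep_fcls.
Qed.

Lemma faddA : associative fadd.
Proof.
elim/fiber_ind=> u hu; elim/fiber_ind=> v hv; elim/fiber_ind=> w hw.
by rewrite !faddE ?catA // ?all_cat ?hu ?hv.
Qed.
Lemma faddC : commutative fadd.
Proof.
elim/fiber_ind=> u hu; elim/fiber_ind=> v hv; rewrite !faddE //.
apply/fclsP; rewrite ?all_cat ?hu ?hv //.
by apply: feq_perm; rewrite perm_catC.
Qed.
Lemma fadd0 : left_id (fcls [::]) fadd.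
Proof. by elim/fiber_ind=> u hu; rewrite faddE. Qed.
Lemma faddN : left_inverse (fcls [::]) fopp fadd.
Proof.
elim/fiber_ind=> u hu; rewrite foppE // faddE ?fib_opp //.
apply/fclsP; rewrite ?all_cat ?fib_opp ?hu //.
elim: u hu => [|p u IH] //= /andP[fp hu].
apply: (@feq_trans _ ([:: (- p.1, p.2); p] ++ (wopp u ++ u))).
  apply: feq_perm; rewrite /= perm_cons -[p :: u]cat1s -[p :: (_ ++ _)]cat1s.
  by rewrite perm_catCA.
rewrite -[[::]]/([::] ++ [::]); apply: feq_cat; last exact: IH.
by case: p {fp}=> a c; apply: feq_Nl.
Qed.
HB.instance Definition _ := GRing.isZmodule.Build fiber faddA faddC fadd0 faddN.

Lemma fclsD w w' : all fib w -> all fib w' ->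
  fcls w + fcls w' = fcls (w ++ w').
Proof. exact: faddE. Qed.
Lemma fcls_nil : fcls [::] = 0. Proof. by []. Qed.

Lemma deg1 (D : bgAlgType act) : deg 1%g 1%g (1 : D).
Proof. by rewrite -(alghom1 rmap_hom); apply: rmap_deg. Qed.
Lemma deg_scal (D : bgAlgType act) k : deg 1%g 1%g (scal k : D).
Proof. by rewrite -[scal k]mulr1; apply/degZ/deg1. Qed.

Lemma fib_scal k : fib (scal k, 1).
Proof.
by apply/asboolP; exists 1%g, 1%g, 1%g; split; [exact: deg_scal|exact: deg1].
Qed.
Lemma fib1 : fib (1, 1).
Proof. by rewrite -(scal1 (K:=K)); apply: fib_scal. Qed.

Lemma fmulA : associative fmul.
Proof.
elim/fiber_ind=> u hu; elim/fiber_ind=> v hv; elim/fiber_ind=> w hw.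
rewrite !fmulE ?fib_mul //; congr fcls.
elim: u {hu} => //= p u IH; rewrite {1}/wmul allpairs_cons -/(wmul _ _) IH.
rewrite /wmul allpairs_cons allpairs_cat; congr (_ ++ _).
rewrite map_allpairs allpairs_mapl; apply: eq_allpairs => q r.
by rewrite /pmul /= !mulrA.
Qed.
Lemma fmul1 : left_id (fcls [:: (1, 1)]) fmul.
Proof.
elim/fiber_ind=> u hu; rewrite fmulE //= ?fib1 //; congr fcls.
rewrite /wmul allpairs_cons allpairs0l cats0 -[RHS]map_id.
by apply: eq_map => [[a c]]; rewrite /pmul !mul1r.
Qed.
Lemma fmulr1 : right_id (fcls [:: (1, 1)]) fmul.
Proof.
elim/fiber_ind=> u hu; rewrite fmulE //= ?fib1 //; congr fcls.
rewrite /wmul allpairs1r -[RHS]map_id.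
by apply: eq_map => [[a c]]; rewrite /pmul !mulr1.
Qed.
Lemma fmulDl : left_distributive fmul +%R.
Proof.
elim/fiber_ind=> u hu; elim/fiber_ind=> v hv; elim/fiber_ind=> w hw.
rewrite fclsD // [in RHS]fmulE // [in RHS]fmulE // fclsD ?fib_mul //.
rewrite fmulE ?all_cat ?hu //.
by rewrite /wmul allpairs_cat.
Qed.
Lemma fmulDr : right_distributive fmul +%R.
Proof.
elim/fiber_ind=> u hu; elim/fiber_ind=> v hv; elim/fiber_ind=> w hw.
rewrite fclsD // [in RHS]fmulE // [in RHS]fmulE // fclsD ?fib_mul //.
rewrite fmulE ?all_cat ?hv //.
apply/fclsP; rewrite ?all_cat ?fib_mul ?all_cat ?hv ?hw //.
by apply: feq_perm; rewrite /wmul perm_allpairs_catr.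
Qed.
HB.instance Definition _ := GRing.Zmodule_isPzRing.Build fiber
  fmulA fmul1 fmulr1 fmulDl fmulDr.

Lemma fclsM w w' : all fib w -> all fib w' -> fcls w * fcls w' = fcls (wmul w w').
Proof. exact: fmulE. Qed.

Definition fscal (k : K) : fiber := ftens (scal k) 1.
Lemma fscalD k l : fscal (k + l) = fscal k + fscal l.
Proof.
rewrite fclsD /= ?fib_scal //; apply/fclsP; rewrite /= ?fib_scal //.
by rewrite scalD; apply: feq_Dl.
Qed.
Lemma fscalM k l : fscal (k * l) = fscal k * fscal l.
Proof.
by rewrite fclsM /= ?fib_scal // /fscal /ftens /wmul /= /pmul scalM /= mulr1.
Qed.
Lemma fscal1 : fscal 1 = 1.
Proof. by rewrite /fscal scal1. Qed.
Lemma fscalC k x : fscal k * x = x * fscal k.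
Proof.
elim/fiber_ind: x => w hw; rewrite !fclsM /= ?fib_scal // /wmul.
rewrite allpairs1r allpairs_cons allpairs0l cats0; congr fcls.
by apply: eq_map => p; rewrite /pmul /= scalC mulr1 mul1r.
Qed.
HB.instance Definition _ :=
  isPzAlgebra.Build K fiber fscalD fscalM fscal1 fscalC.

(* The image of \sum_h A_(g,h) (x) C_(h,k). *)
Definition fdeg (g k : G) (x : fiber) : Prop :=
  exists2 w, forall p, p \in w -> exists h, deg g h p.1 /\ deg h k p.2
           & x = fcls w.

Let wfib g k (w : seq (A * C)) :
  (forall p, p \in w -> exists h, deg g h p.1 /\ deg h k p.2) -> all fib w.
Proof.
by move=> hw; apply/allP=> p /hw [h hh]; apply/asboolP; exists g, h, k.
Qed.

Lemma fdeg0 g h : fdeg g h 0.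
Proof. by exists [::]. Qed.
Lemma fdegD g h x y : fdeg g h x -> fdeg g h y -> fdeg g h (x + y).
Proof.
move=> [w hw ->] [w' hw' ->]; exists (w ++ w').
  by move=> p; rewrite mem_cat => /orP[/hw|/hw'].
by rewrite fclsD ?(wfib hw) ?(wfib hw').
Qed.
Lemma fdegM g h g' h' x y :
  fdeg g h x -> fdeg g' h' y -> fdeg (g * g')%g (h * h')%g (x * y).
Proof.
move=> [w hw ->] [w' hw' ->]; exists (wmul w w').
  move=> _ /allpairsP[[p q] [/hw [k [d d']] /hw' [k' [d1 d1']] ->]].
  by exists (k * k')%g; split; [exact: degM d d1|exact: degM d' d1'].
by rewrite fclsM ?(wfib hw) ?(wfib hw').
Qed.
Lemma fdeg_tens g h k a c : deg g h a -> deg h k c -> fdeg g k (ftens a c).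
Proof.
by exists [:: (a, c)] => // p; rewrite inE => /eqP ->; exists h.
Qed.
Lemma fdegZ g h (k : K) x : fdeg g h x -> fdeg g h (scal k * x).
Proof.
move=> d; rewrite -[g]mul1g -[h]mul1g; apply: fdegM => //.
by apply: (@fdeg_tens _ 1%g); [apply: deg_scal|apply: deg1].
Qed.

Lemma fcls_sum w : all fib w -> fcls w = \sum_(p <- w) ftens p.1 p.2.
Proof.
elim: w => [|[a c] w IH] /=; first by rewrite big_nil.
by case/andP=> fp fw; rewrite big_cons -IH // fclsD //= fp.
Qed.

Lemma fdeg_span (x : fiber) : exists2 t : seq fiber,
  forall y, y \in t -> exists g h, fdeg g h y & x = \sum_(y <- t) y.
Proof.
elim/fiber_ind: x => w hw; exists [seq ftens p.1 p.2 | p <- w].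
  move=> _ /mapP[p /(allP hw) /asboolP[g [h [k [d d']]]] ->].
  by exists g, k; apply: fdeg_tens d d'.
by rewrite big_map fcls_sum.
Qed.

Lemma fproj g k : exists P : fiber -> fiber, {morph P : x y / x + y} /\
  forall g' k' x, fdeg g' k' x -> P x = if (g' == g) && (k' == k) then x else 0.
Proof.
have [pA [pAD pAZ pAE]] := degproj A [pred d : G * G | d.1 == g].
have [pC [pCD pCZ pCE]] := degproj C [pred d : G * G | d.2 == k].
pose f (p : A * C) := (pA p.1, pC p.2).
have pA0 : pA 0 = 0 by apply: (addrI (pA 0)); rewrite -pAD !addr0.
have hom (D : bgAlgType act) (b : bool) g' h' (x : D) :
    deg g' h' x -> deg g' h' (if b then x else 0).
  by case: b => // _; apply: deg0.
have f_fib p : fib p -> fib (f p).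
  move=> /asboolP[g' [h' [k' [d d']]]]; apply/asboolP; exists g', h', k'.
  by rewrite /= (pAE _ _ _ d) (pCE _ _ _ d'); split; apply: hom.
have f_all w : all fib w -> all fib (map f w).
  by move=> /allP hw; apply/allP=> _ /mapP[p /hw fp ->]; apply: f_fib.
have f_feq w w' : feq w w' -> feq (map f w) (map f w').
  elim=> {w w'}.
  - by move=> w w' _ h; apply: feq_sym.
  - by move=> w1 w2 w3 _ h _ h'; apply: feq_trans h h'.
  - by move=> w w' h; apply: feq_perm; apply: perm_map.
  - by move=> w1 w1' w2 w2' _ h _ h'; rewrite !map_cat; apply: feq_cat.
  - by move=> c; rewrite /f /= pA0; apply: feq_0.
  - by move=> a a' c; rewrite /f /= pAD; apply: feq_Dl.
  - by move=> a c c'; rewrite /f /= pCD; apply: feq_Dr.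
  - by move=> l a c; rewrite /f /= pAZ pCZ; apply: feq_scal.
  - move=> p q b fp fq.
    move: (fp) (fq) => /asboolP[g1 [h1 [k1 [d1 d1']]]].
    move=> /asboolP[g2 [h2 [k2 [d2 d2']]]]; rewrite /f /=.
    have e1 := degM _ _ _ _ _ _ (degM _ _ _ _ _ _ d1 (smap_deg b)) d2.
    have e2 := degM _ _ _ _ _ _ d1 d2.
    have e1' := degM _ _ _ _ _ _ (degM _ _ _ _ _ _ d1' (rmap_deg b)) d2'.
    have e2' := degM _ _ _ _ _ _ d1' d2'.
    rewrite (pAE _ _ _ e1) (pAE _ _ _ e2) (pCE _ _ _ e1') (pCE _ _ _ e2') /=.
    rewrite !mulg1; case: eqP => _.
      case: eqP => _; first exact: feq_ideal.
      by apply: feq_trans (feq_0r _) _; apply: feq_sym; apply: feq_0r.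
    by apply: feq_trans (feq_0 _) _; apply: feq_sym; apply: feq_0.
pose P x := fcls (map f (frep x)).
have PE w : all fib w -> P (fcls w) = fcls (map f w).
  move=> hw; apply/fclsP; rewrite ?f_all ?frep_fib //.
  by apply: f_feq; apply: frep_fcls.
exists P; split.
  elim/fiber_ind=> u hu; elim/fiber_ind=> v hv.
  by rewrite fclsD // !PE ?all_cat ?hu // map_cat fclsD ?f_all.
move=> g' k' x [w hw ->]; rewrite PE ?(wfib hw) //.
have fw := wfib hw; have ffw := f_all _ fw.
case: ifP => [/andP[/eqP eg /eqP ek]|e].
  congr fcls; rewrite -[RHS]map_id; apply/eq_in_map => [[a c] /hw [h /= [d d']]].
  by rewrite /f /= (pAE _ _ _ d) (pCE _ _ _ d') /= eg ek !eqxx.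
rewrite -fcls_nil; apply/fclsP => //; elim: w hw {fw ffw} => //= [[a c]] w IH hw.
rewrite -[X in feq _ X]/([::] ++ [::]) -cat1s; apply: feq_cat; last first.
  by apply: IH => p pw; apply: hw; rewrite inE pw orbT.
have [h /= [d d']] := hw _ (mem_head _ _).
rewrite /f /= (pAE _ _ _ d) (pCE _ _ _ d') /=; move/negbT: e.
by rewrite negb_and => /orP[] /negPf ->; [apply: feq_0|apply: feq_0r].
Qed.

Lemma fdeg_indep (s : seq (G * G)) (f : G * G -> fiber) : uniq s ->
    (forall d, d \in s -> fdeg d.1 d.2 (f d)) ->
    \sum_(d <- s) f d = 0 -> forall d, d \in s -> f d = 0.
Proof.
move=> us fd fs [g k] ds; have [P [PD PE]] := fproj g k.
have P0 : P 0 = 0 by apply: (addrI (P 0)); rewrite -PD !addr0.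
move: (congr1 P fs); rewrite (big_morph P PD P0) P0 (bigD1_seq (g, k)) //=.
rewrite (PE _ _ _ (fd _ ds)) /= !eqxx big_seq_cond big1 ?addr0 // => d.
move=> /andP[/fd hd nd]; rewrite (PE _ _ _ hd).
by rewrite -[_ && _]/((d.1, d.2) == (g, k)) -surjective_pairing (negPf nd).
Qed.

Definition fr (b : B) : fiber := ftens (rmap b) 1.
Definition fs (b : B) : fiber := ftens 1 (smap b).

Let fibr b : fib (rmap b, 1).
Proof.
by apply/asboolP; exists 1%g, 1%g, 1%g; split; [exact: rmap_deg|exact: deg1].
Qed.
Let fibs b : fib (1, smap b).
Proof.
by apply/asboolP; exists 1%g, 1%g, 1%g; split; [exact: deg1|exact: smap_deg].
Qed.

Lemma fr_hom : is_alghom fr.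
Proof.
split=> [x y|x y|k]; last by rewrite /fr (alghom_scal rmap_hom).
- rewrite fclsD /= ?fibr //; apply/fclsP; rewrite /= ?fibr //.
  by rewrite (alghomD rmap_hom); apply: feq_Dl.
- rewrite fclsM /= ?fibr // /wmul /= /pmul /= mulr1.
  by rewrite /fr (alghomM rmap_hom).
Qed.
Lemma fs_hom : is_alghom fs.
Proof.
split=> [x y|x y|k].
- rewrite fclsD /= ?fibs //; apply/fclsP; rewrite /= ?fibs //.
  by rewrite (alghomD smap_hom); apply: feq_Dr.
- rewrite fclsM /= ?fibs // /wmul /= /pmul /= mulr1.
  by rewrite /fs (alghomM smap_hom).
- rewrite /fs; apply/fclsP; rewrite /= ?fibs ?fib_scal //.
  rewrite (alghom_scal smap_hom); apply: feq_sym.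
  by have := feq_scal k 1 1; rewrite !mulr1.
Qed.
Lemma fr_deg b : fdeg 1%g 1%g (fr b).
Proof. by apply: (@fdeg_tens _ 1%g); [exact: rmap_deg|exact: deg1]. Qed.
Lemma fs_deg b : fdeg 1%g 1%g (fs b).
Proof. by apply: (@fdeg_tens _ 1%g); [exact: deg1|exact: smap_deg]. Qed.
Lemma frsC b c : fr b * fs c = fs c * fr b.
Proof.
by rewrite !fclsM /= ?fibr ?fibs // /wmul /= /pmul /= !mulr1 !mul1r.
Qed.
Lemma fr_act g h x b : fdeg g h x -> x * fr b = fr (act g b) * x.
Proof.
move=> [w hw ->]; rewrite !fclsM /= ?fibr ?(wfib hw) // /wmul.
rewrite allpairs1r allpairs_cons allpairs0l cats0; congr fcls.
apply/eq_in_map => p /hw [k [d _]].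
by rewrite /pmul /= mulr1 mul1r (rmap_act _ _ _ _ d).
Qed.
Lemma fs_act g h x b : fdeg g h x -> x * fs b = fs (act h b) * x.
Proof.
move=> [w hw ->]; rewrite !fclsM /= ?fibs ?(wfib hw) // /wmul.
rewrite allpairs1r allpairs_cons allpairs0l cats0; congr fcls.
apply/eq_in_map => p /hw [k [_ d]].
by rewrite /pmul /= mulr1 mul1r (smap_act _ _ _ _ d).
Qed.

HB.instance Definition _ := isBGAlgebra.Build K B G act fiber
  fdeg0 fdegD fdegZ fdeg_span fdeg_indep fdegM fr_hom fs_hom
  fr_deg fs_deg frsC fr_act fs_act.

Section Lift.
Variables (V : zmodType) (f : A -> C -> V).
Hypothesis fDl : forall a a' c, f (a + a') c = f a c + f a' c.
Hypothesis fDr : forall a c c', f a (c + c') = f a c + f a c'.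
Hypothesis fZ : forall (k : K) a c, f (scal k * a) c = f a (scal k * c).
Hypothesis fI : forall p q b, fib p -> fib q ->
  f (p.1 * smap b * q.1) (p.2 * q.2) = f (p.1 * q.1) (p.2 * rmap b * q.2).

Definition flift (x : fiber) : V := \sum_(p <- frep x) f p.1 p.2.

Lemma feq_lift w w' : feq w w' ->
  \sum_(p <- w) f p.1 p.2 = \sum_(p <- w') f p.1 p.2.
Proof.
elim=> {w w'}.
- by [].
- by move=> ? ? ? _ -> _ ->.
- by move=> w w' h; apply: perm_big.
- by move=> w1 w1' w2 w2' _ h _ h'; rewrite !big_cat h h'.
- move=> c; rewrite big_seq1 big_nil; apply: (addrI (f 0 c)).
  by rewrite -fDl !addr0.
- by move=> a a' c; rewrite !(big_cons, big_nil) !addr0 fDl.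
- by move=> a c c'; rewrite !(big_cons, big_nil) !addr0 fDr.
- by move=> k a c; rewrite !big_seq1 fZ.
- by move=> p q b fp fq; rewrite !big_seq1 fI.
Qed.

Lemma fliftE w : all fib w -> flift (fcls w) = \sum_(p <- w) f p.1 p.2.
Proof. by move=> hw; apply/feq_lift/frep_fcls. Qed.

Lemma fliftD x y : flift (x + y) = flift x + flift y.
Proof.
elim/fiber_ind: x => u hu; elim/fiber_ind: y => v hv.
by rewrite fclsD // !fliftE ?all_cat ?hu // big_cat.
Qed.
End Lift.

End Fiber.
Arguments fiber {K B G act} A C.

Lemma perm_allpairs_swap (S T R : eqType) (f : S -> T -> R) s t :
  perm_eq [seq f x y | x <- s, y <- t] [seq f x y | y <- t, x <- s].
Proof.
elim: s => [|x s IH] /=; first by elim: t.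
by rewrite perm_sym (perm_allpairs_consr (fun y x => f x y)) perm_cat2l perm_sym.
Qed.

Section FiberStar.
Variables (K : numClosedFieldType) (B : comStarAlgType K) (G : groupType).
Variables (act : starAction B G) (A C : bgStarAlgType act).

Definition wstar : seq (A * C) -> seq (A * C) :=
  map (fun p => (star p.1, star p.2)).

Lemma fib_pstar (p : A * C) : fib p -> fib (star p.1, star p.2).
Proof.
move=> /asboolP[g [h [k [d d']]]]; apply/asboolP.
by exists g^-1%g, h^-1%g, k^-1%g; split; apply: deg_star.
Qed.

Lemma fib_star w : all (@fib _ _ _ _ A C) w -> all (@fib _ _ _ _ A C) (wstar w).
Proof.
by move=> /allP hw; apply/allP => _ /mapP[p /hw fp ->]; apply: fib_pstar.
Qed.

Lemma feq_star w w' : feq w w' -> feq (wstar w) (wstar w').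
Proof.
elim=> {w w'}.
- by move=> w w' _ h; apply: feq_sym.
- by move=> w1 w2 w3 _ h _ h'; apply: feq_trans h h'.
- by move=> w w' h; apply: feq_perm; apply: perm_map.
- by move=> w1 w1' w2 w2' _ h _ h'; rewrite /wstar !map_cat; apply: feq_cat.
- by move=> c; rewrite /= star0; apply: feq_0.
- by move=> a a' c; rewrite /= starD; apply: feq_Dl.
- by move=> a c c'; rewrite /= starD; apply: feq_Dr.
- by move=> k a c; rewrite /= !starM !star_scal -!scalC; apply: feq_scal.
- move=> p q b fp fq; rewrite /= !starM smap_star rmap_star !mulrA.
  exact: (feq_ideal (star b) (fib_pstar fq) (fib_pstar fp)).
Qed.

Definition fstar (x : fiber A C) : fiber A C := fcls (wstar (frep x)).

Lemma fstarE w : all (@fib _ _ _ _ A C) w -> fstar (fcls w) = fcls (wstar w).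
Proof.
move=> hw; apply/fclsP; rewrite ?fib_star ?frep_fib //.
by apply: feq_star; apply: frep_fcls.
Qed.

Lemma fstarD x y : fstar (x + y) = fstar x + fstar y.
Proof.
elim/fiber_ind: x => u hu; elim/fiber_ind: y => v hv.
by rewrite fclsD // !fstarE ?all_cat ?hu // /wstar map_cat fclsD ?fib_star.
Qed.
Lemma fstarM x y : fstar (x * y) = fstar y * fstar x.
Proof.
elim/fiber_ind: x => u hu; elim/fiber_ind: y => v hv.
rewrite fclsM // !fstarE ?fib_mul // fclsM ?fib_star //.
apply/fclsP; rewrite ?fib_star ?fib_mul ?fib_star //.
apply: feq_perm; rewrite /wmul /wstar map_allpairs allpairs_mapl allpairs_mapr.
rewrite (permPl (perm_allpairs_swap _ _ _)).
have e2p (s t : seq (A * C)) : s = t -> perm_eq s t by move=> ->.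
apply: e2p.
by apply: eq_allpairs => p q; rewrite /pmul /= !starM.
Qed.
Lemma fstar_scal k : fstar (scal k) = scal k^*.
Proof.
rewrite fstarE /= ?fib_scal // star_scal star1; exact: erefl.
Qed.
Lemma fstarK : involutive fstar.
Proof.
elim/fiber_ind=> w hw; rewrite !fstarE ?fib_star //; congr fcls.
rewrite /wstar -map_comp -[RHS]map_id; apply: eq_map => [[a c]] /=.
by rewrite !starK.
Qed.
HB.instance Definition _ := hasStar.Build K (fiber A C)
  fstarD fstarM fstar_scal fstarK.

Lemma fdeg_star g h (x : fiber A C) :
  fdeg g h x -> fdeg g^-1%g h^-1%g (star x).
Proof.
move=> [w hw ->]; exists (wstar w).
  move=> _ /mapP[p /hw [k [d d']] ->]; exists k^-1%g.
  by split; apply: deg_star.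
by apply: fstarE; apply/allP => p /hw [k dd]; apply/asboolP; exists g, k, h.
Qed.
Lemma fr_star b : star (fr A C b) = fr A C (star b).
Proof.
rewrite [LHS]fstarE /= ?rmap_star ?star1 //.
by rewrite andbT; apply/asboolP; exists 1%g, 1%g, 1%g; split;
  [exact: rmap_deg|exact: deg1].
Qed.
Lemma fs_star b : star (fs A C b) = fs A C (star b).
Proof.
rewrite [LHS]fstarE /= ?smap_star ?star1 //.
by rewrite andbT; apply/asboolP; exists 1%g, 1%g, 1%g; split;
  [exact: deg1|exact: smap_deg].
Qed.
HB.instance Definition _ := isBGStarAlgebra.Build K B G act (fiber A C)
  fdeg_star fr_star fs_star.
End FiberStar.

Section FiberMor.
Variables (K : numClosedFieldType) (B : comStarAlgType K) (G : groupType).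
Variable act : starAction B G.

Section Fmor.
Variables (A C A' C' : bgAlgType act) (f : bgMor A A') (g : bgMor C C').

Definition wmor : seq (A * C) -> seq (A' * C') :=
  map (fun p => (f p.1, g p.2)).

Lemma fib_pmor p : fib p -> fib (f p.1, g p.2).
Proof.
move=> /asboolP[k [h [l [d d']]]]; apply/asboolP.
by exists k, h, l; split; apply: mor_deg.
Qed.

Lemma fib_mor w : all (@fib _ _ _ _ A C) w -> all (@fib _ _ _ _ A' C') (wmor w).
Proof.
by move=> /allP hw; apply/allP => _ /mapP[p /hw fp ->]; apply: fib_pmor.
Qed.

Lemma feq_mor w w' : feq w w' -> feq (wmor w) (wmor w').
Proof.
have [fh gh] := (mor_hom f, mor_hom g).
elim=> {w w'}.
- by move=> w w' _ h; apply: feq_sym.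
- by move=> w1 w2 w3 _ h _ h'; apply: feq_trans h h'.
- by move=> w w' h; apply: feq_perm; apply: perm_map.
- by move=> w1 w1' w2 w2' _ h _ h'; rewrite /wmor !map_cat; apply: feq_cat.
- by move=> c; rewrite /= (alghom0 fh); apply: feq_0.
- by move=> a a' c; rewrite /= (alghomD fh); apply: feq_Dl.
- by move=> a c c'; rewrite /= (alghomD gh); apply: feq_Dr.
- move=> k a c; rewrite /= (alghomM fh) (alghomM gh).
  by rewrite (alghom_scal fh) (alghom_scal gh); apply: feq_scal.
- move=> p q b fp fq; rewrite /= !(alghomM fh) !(alghomM gh) mor_s mor_r.
  exact: (feq_ideal b (fib_pmor fp) (fib_pmor fq)).
Qed.

Definition fmap (x : fiber A C) : fiber A' C' := fcls (wmor (frep x)).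

Lemma fmapE w : all (@fib _ _ _ _ A C) w -> fmap (fcls w) = fcls (wmor w).
Proof.
move=> hw; apply/fclsP; rewrite ?fib_mor ?frep_fib //.
by apply: feq_mor; apply: frep_fcls.
Qed.

Lemma fmap_hom : is_alghom fmap.
Proof.
have [fh gh] := (mor_hom f, mor_hom g); split=> [x y|x y|k].
- elim/fiber_ind: x => u hu; elim/fiber_ind: y => v hv.
  by rewrite fclsD // !fmapE ?all_cat ?hu // /wmor map_cat fclsD ?fib_mor.
- elim/fiber_ind: x => u hu; elim/fiber_ind: y => v hv.
  rewrite fclsM // !fmapE ?fib_mul // fclsM ?fib_mor //; congr fcls.
  rewrite /wmul /wmor map_allpairs allpairs_mapl allpairs_mapr.
  by apply: eq_allpairs => p q; rewrite /pmul /= (alghomM fh) (alghomM gh).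
- by rewrite fmapE /= ?fib_scal // (alghom_scal fh) (alghom1 gh).
Qed.
Lemma fmap_deg k l x : deg k l x -> deg k l (fmap x).
Proof.
move=> [w hw ->]; exists (wmor w).
  by move=> _ /mapP[p /hw [h [d d']] ->]; exists h; split; apply: mor_deg.
by apply: fmapE; apply/allP => p /hw [h dd]; apply/asboolP; exists k, h, l.
Qed.
Lemma fmap_r b : fmap (rmap b) = rmap b.
Proof.
rewrite [LHS]fmapE /= ?mor_r ?(alghom1 (mor_hom g)) //.
by rewrite andbT; apply/asboolP; exists 1%g, 1%g, 1%g; split;
  [exact: rmap_deg|exact: deg1].
Qed.
Lemma fmap_s b : fmap (smap b) = smap b.
Proof.
rewrite [LHS]fmapE /= ?mor_s ?(alghom1 (mor_hom f)) //.
by rewrite andbT; apply/asboolP; exists 1%g, 1%g, 1%g; split;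
  [exact: deg1|exact: smap_deg].
Qed.
Definition fmor : bgMor (fiber A C) (fiber A' C') :=
  BGMor fmap_hom fmap_deg fmap_r fmap_s.
End Fmor.

Section LiftMor.
Variables (A C D : bgAlgType act) (f : A -> C -> D).
Hypothesis fDl : forall a a' c, f (a + a') c = f a c + f a' c.
Hypothesis fDr : forall a c c', f a (c + c') = f a c + f a c'.
Hypothesis fM : forall p q : A * C, fib p -> fib q ->
  f (p.1 * q.1) (p.2 * q.2) = f p.1 p.2 * f q.1 q.2.
Hypothesis fZ : forall (k : K) a c, f (scal k * a) c = f a (scal k * c).
Hypothesis fk : forall k : K, f (scal k) 1 = scal k.
Hypothesis fI : forall b, f (smap b) 1 = f 1 (rmap b).
Hypothesis fr1 : forall b, f (rmap b) 1 = rmap b.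
Hypothesis fs1 : forall b, f 1 (smap b) = smap b.
Hypothesis fdeg1 : forall g h k a c,
  deg g h a -> deg h k c -> deg g k (f a c).

Let fibE (a : A) (c : C) :
  deg 1%g 1%g a -> deg 1%g 1%g c -> fib (a, c).
Proof. by move=> da dc; apply/asboolP; exists 1%g, 1%g, 1%g. Qed.

Let fI' (p q : A * C) b : fib p -> fib q ->
  f (p.1 * smap b * q.1) (p.2 * q.2) = f (p.1 * q.1) (p.2 * rmap b * q.2).
Proof.
move=> fp fq; rewrite -{1}[p.2]mulr1 -{2}[p.1]mulr1.
have fsb : fib (smap b : A, 1 : C) by apply/fibE; [exact: smap_deg|exact: deg1].
have frb : fib (1 : A, rmap b : C) by apply/fibE; [exact: deg1|exact: rmap_deg].
rewrite (fM (fibM fp fsb) fq) (fM (fibM fp frb) fq) /=.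
by rewrite (fM fp fsb) (fM fp frb) /= fI.
Qed.

Local Notation L := (flift f).
Let LE := fliftE fDl fDr fZ fI'.

Lemma flift_hom : is_alghom L.
Proof.
split=> [x y|x y|k]; first exact: (fliftD fDl fDr fZ fI').
- elim/fiber_ind: x => u hu; elim/fiber_ind: y => v hv.
  rewrite fclsM // !LE ?fib_mul // big_distrlr /= /wmul big_allpairs_dep.
  rewrite big_seq [RHS]big_seq; apply: eq_bigr => p pu.
  rewrite big_seq [RHS]big_seq.
  apply: eq_bigr => q qv; exact: fM (allP hu _ pu) (allP hv _ qv).
- by rewrite [LHS]LE /= ?big_seq1 ?fk // fib_scal.
Qed.
Lemma flift_deg g k x : deg g k x -> deg g k (L x).
Proof.
move=> [w hw ->]; rewrite LE; last first.
  by apply/allP => p /hw [h dd]; apply/asboolP; exists g, h, k.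
rewrite big_seq; apply: (big_ind (deg g k)); [exact: deg0|exact: degD|].
by move=> p /hw [h [d d']]; apply: fdeg1 d d'.
Qed.
Lemma flift_r b : L (rmap b) = rmap b.
Proof.
rewrite [LHS]LE /= ?big_seq1 //= andbT; apply: fibE; first exact: rmap_deg.
exact: deg1.
Qed.
Lemma flift_s b : L (smap b) = smap b.
Proof.
rewrite [LHS]LE /= ?big_seq1 //= andbT; apply: fibE; first exact: deg1.
exact: smap_deg.
Qed.
Definition flift_mor : bgMor (fiber A C) D :=
  BGMor flift_hom flift_deg flift_r flift_s.
End LiftMor.

End FiberMor.

Section Units.
Variables (K : numClosedFieldType) (B : comStarAlgType K) (G : groupType).
Variables (act : starAction B G) (A : bgAlgType act).

(* b g |-> r(b), b g |-> s(b) and g b |-> s(b). *)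
Definition rhat : crossed act -> A := crext (fun _ b => rmap b).
Definition shat : crossed act -> A := crext (fun _ b => smap b).
Definition scheck : crossed act -> A := crext (fun g b => smap (act g^-1%g b)).

Section Hat.
Variable t : B -> A.
Hypothesis t_hom : is_alghom t.
Local Notation hat := (crext (act := act) (fun _ b => t b)).
Let tD (g : G) b c : t (b + c) = t b + t c.
Proof. exact: alghomD t_hom b c. Qed.
Lemma hatE g b : hat (mono _ g b) = t b.
Proof. exact: (@crext_mono _ _ _ act _ (fun _ b => t b) tD). Qed.
Lemma hatD x y : hat (x + y) = hat x + hat y.
Proof. exact: (@crextD _ _ _ act _ (fun _ b => t b) tD). Qed.
Lemma hat0 : hat 0 = 0.
Proof. exact: (@crext0 _ _ _ act _ (fun _ b => t b) tD). Qed.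
Lemma hatZ k x : hat (scal k * x) = scal k * hat x.
Proof.
elim/crossed_ind: x => [g b|x y IH IH']; last first.
  by rewrite mulrDr !hatD mulrDr IH IH'.
rewrite monoM !hatE act_1 (alghomM t_hom); congr (_ * _).
exact: alghom_scal.
Qed.
Lemma hat_scal k : hat (scal k) = scal k.
Proof. by rewrite hatE (alghom_scal t_hom). Qed.
Lemma hat1 : hat 1 = 1.
Proof. by rewrite hatE (alghom1 t_hom). Qed.
End Hat.

Definition lunit_fun (x : crossed act) (a : A) : A := rhat x * a.
Definition runit_fun (a : A) (x : crossed act) : A := shat x * a.

Lemma lunit_Dl x y a : lunit_fun (x + y) a = lunit_fun x a + lunit_fun y a.
Proof. by rewrite /lunit_fun /rhat (hatD rmap_hom) mulrDl. Qed.
Lemma lunit_Dr x a b : lunit_fun x (a + b) = lunit_fun x a + lunit_fun x b.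
Proof. exact: mulrDr. Qed.
Lemma lunit_M (p q : crossed act * A) : fib p -> fib q ->
  lunit_fun (p.1 * q.1) (p.2 * q.2) = lunit_fun p.1 p.2 * lunit_fun q.1 q.2.
Proof.
move=> /asboolP[g [h [k [[b ->] d]]]] /asboolP[g' [h' [k' [[b' ->] d']]]].
rewrite /lunit_fun /rhat; case: (g =P h) => [e|_]; last first.
  by rewrite mul0r !(hat0 rmap_hom) !mul0r.
case: (g' =P h') => [_|_]; last first.
  by rewrite mulr0 !(hat0 rmap_hom) !mul0r mulr0.
rewrite monoM !(hatE rmap_hom) (alghomM rmap_hom) e.
by rewrite -!mulrA; congr (_ * _); rewrite !mulrA (rmap_act _ _ _ _ d).
Qed.
Lemma lunit_Z (k : K) x a : lunit_fun (scal k * x) a = lunit_fun x (scal k * a).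
Proof. by rewrite /lunit_fun /rhat (hatZ rmap_hom) scalC mulrA. Qed.
Lemma lunit_k (k : K) : lunit_fun (scal k) 1 = scal k.
Proof. by rewrite /lunit_fun /rhat (hat_scal rmap_hom) mulr1. Qed.
Lemma lunit_I b : lunit_fun (smap b) 1 = lunit_fun 1 (rmap b).
Proof.
by rewrite /lunit_fun /rhat (hatE rmap_hom) (hat1 rmap_hom) mulr1 mul1r.
Qed.
Lemma lunit_r b : lunit_fun (rmap b) 1 = rmap b.
Proof. by rewrite /lunit_fun /rhat (hatE rmap_hom) mulr1. Qed.
Lemma lunit_s b : lunit_fun 1 (smap b) = smap b.
Proof. by rewrite /lunit_fun /rhat (hat1 rmap_hom) mul1r. Qed.
Lemma lunit_deg g h k x a :
  deg g h x -> deg h k a -> deg g k (lunit_fun x a).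
Proof.
move=> [b ->] da; rewrite /lunit_fun /rhat; case: (g =P h) => [->|_]; last first.
  by rewrite (hat0 rmap_hom) mul0r; apply: deg0.
rewrite (hatE rmap_hom) -[h]mul1g -[k]mul1g; apply: degM => //.
exact: rmap_deg.
Qed.

Lemma runit_Dl a b x : runit_fun (a + b) x = runit_fun a x + runit_fun b x.
Proof. exact: mulrDr. Qed.
Lemma runit_Dr a x y : runit_fun a (x + y) = runit_fun a x + runit_fun a y.
Proof. by rewrite /runit_fun /shat (hatD smap_hom) mulrDl. Qed.
Lemma runit_M (p q : A * crossed act) : fib p -> fib q ->
  runit_fun (p.1 * q.1) (p.2 * q.2) = runit_fun p.1 p.2 * runit_fun q.1 q.2.
Proof.
move=> /asboolP[g [h [k [d [b ->]]]]] /asboolP[g' [h' [k' [d' [b' ->]]]]].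
rewrite /runit_fun /shat; case: (h =P k) => [e|_]; last first.
  by rewrite mul0r !(hat0 smap_hom) !mul0r.
case: (h' =P k') => [_|_]; last first.
  by rewrite mulr0 !(hat0 smap_hom) !mul0r mulr0.
rewrite monoM !(hatE smap_hom) (alghomM smap_hom).
by rewrite -!mulrA; congr (_ * _); rewrite !mulrA (smap_act _ _ _ _ d).
Qed.
Lemma runit_Z (k : K) a x : runit_fun (scal k * a) x = runit_fun a (scal k * x).
Proof. by rewrite /runit_fun /shat (hatZ smap_hom) mulrA -scalC. Qed.
Lemma runit_k (k : K) : runit_fun (scal k) 1 = scal k.
Proof. by rewrite /runit_fun /shat (hat1 smap_hom) mul1r. Qed.
Lemma runit_I b : runit_fun (smap b) 1 = runit_fun 1 (rmap b).
Proof.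
by rewrite /runit_fun /shat (hat1 smap_hom) (hatE smap_hom) mulr1 mul1r.
Qed.
Lemma runit_r b : runit_fun (rmap b) 1 = rmap b.
Proof. by rewrite /runit_fun /shat (hat1 smap_hom) mul1r. Qed.
Lemma runit_s b : runit_fun 1 (smap b) = smap b.
Proof. by rewrite /runit_fun /shat (hatE smap_hom) mulr1. Qed.
Lemma runit_deg g h k a x :
  deg g h a -> deg h k x -> deg g k (runit_fun a x).
Proof.
move=> da [b ->]; rewrite /runit_fun /shat; case: (h =P k) => [<-|_]; last first.
  by rewrite (hat0 smap_hom) mul0r; apply: deg0.
rewrite (hatE smap_hom) -[g]mul1g -[h]mul1g; apply: degM => //.
exact: smap_deg.
Qed.

(* The canonical isomorphisms removing a factor [crossed act]. *)
Definition lunit : bgMor (fiber (crossed act) A) A :=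
  flift_mor lunit_Dl lunit_Dr lunit_M lunit_Z lunit_k lunit_I lunit_r lunit_s
    lunit_deg.
Definition runit : bgMor (fiber A (crossed act)) A :=
  flift_mor runit_Dl runit_Dr runit_M runit_Z runit_k runit_I runit_r runit_s
    runit_deg.
End Units.
Arguments lunit {K B G act} A.
Arguments runit {K B G act} A.

Section Hopf.
Variables (K : numClosedFieldType) (B : comStarAlgType K) (G : groupType).
Variable act : starAction B G.

(* The graph of the canonical isomorphism
   (A (x) C) (x) D -> A (x) (C (x) D), (a (x) c) (x) d |-> a (x) (c (x) d). *)
Definition reassoc (A C D : bgAlgType act)
    (t : fiber (fiber A C) D) (t' : fiber A (fiber C D)) : Prop :=
  exists w : seq (A * C * D),
    [/\ forall q, q \in w -> exists g h k l,
           [/\ deg g h q.1.1, deg h k q.1.2 & deg k l q.2],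
        t = \sum_(q <- w) ftens (ftens q.1.1 q.1.2) q.2
      & t' = \sum_(q <- w) ftens q.1.1 (ftens q.1.2 q.2)].

(* Sweedler sums are taken over every representation [w] of \Delta(a); as
   antipode is a morphism into coop A, they do not depend on [w]. *)
Record hopfAlgebroid (A : bgAlgType act) := HopfAlgebroid {
  comult : bgMor A (fiber A A);
  counit : bgMor A (crossed act);
  antipode_mor : bgMor A (coop A);
  antipode : A -> A := fun a => (antipode_mor a : A);
  coassoc : forall a, reassoc (fmor comult (idmor A) (comult a))
                              (fmor (idmor A) comult (comult a));
  counitl : forall a, lunit A (fmor counit (idmor A) (comult a)) = a;
  counitr : forall a, runit A (fmor (idmor A) counit (comult a)) = a;
  antipodel : forall a w, all (@fib _ _ _ _ A A) w -> comult a = fcls w ->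
    \sum_(p <- w) antipode p.1 * p.2 = scheck A (counit a);
  antipoder : forall a w, all (@fib _ _ _ _ A A) w -> comult a = fcls w ->
    \sum_(p <- w) p.1 * antipode p.2 = rhat A (counit a);
}.

Definition hopf_star (A : bgStarAlgType act) (H : hopfAlgebroid A) : Prop :=
  star_preserving (comult H) /\ star_preserving (counit H).

Section Characters.
Variables (A : bgAlgType act) (H : hopfAlgebroid A).
Variable theta : int -> bgMor A (crossed act).

Definition character_group : Prop :=
  [/\ forall k l a,
         lunit (crossed act) (fmor (theta k) (theta l) (comult H a))
         = theta (k + l) a,
      forall a, theta 0 a = counit H a
    & forall k a, theta k (antipode H a) = crantip (theta (- k) a)].

Definition scaling : Prop := forall a,
  antipode H (antipode H a) =
  runit A (fmor (lunit A) (idmor (crossed act))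
    (fmor (fmor (theta 1) (idmor A)) (theta (- 1))
      (fmor (comult H) (idmor A) (comult H a)))).
End Characters.

Definition imaginary (A : bgStarAlgType act)
    (theta : int -> bgMor A (crossed act)) : Prop :=
  forall k a, theta k (star a) = star (theta (- k) a).

End Hopf.

Definition is_mxinv (R : pzRingType) n (X Y : 'M[R]_n) : Prop :=
  X *m Y = 1%:M /\ Y *m X = 1%:M.

(* X ^ k for an integer k, where Y is the inverse of X. *)
Definition mxpowz (R : pzRingType) n (X Y : 'M[R]_n) (k : int) : 'M[R]_n :=
  match k with Posz m => X ^+ m | Negz m => Y ^+ m.+1 end.

Definition mxbar (K : numClosedFieldType) (A : starAlgType K) n (X : 'M[A]_n) :
  'M[A]_n := map_mx star X.
Definition mxstar (K : numClosedFieldType) (A : starAlgType K) n (X : 'M[A]_n) :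
  'M[A]_n := (mxbar X)^T.

Section FreeUnitary.
Variables (K : numClosedFieldType) (B : comStarAlgType K) (G : groupType).
Variables (act : starAction B G) (n : nat) (gam : 'I_n -> G).

Definition iota_mx (X : 'M[B]_n) : 'M[crossed act]_n := map_mx (iota act) X.

Definition nabla : 'M[crossed act]_n := diag_mx (\row_i mono act (gam i) 1).
Definition nablaV : 'M[crossed act]_n :=
  diag_mx (\row_i mono act (gam i)^-1%g 1).

(* Membership in M_n(B), as a subset of M_n(crossed act), and the corresponding
   matrix over B. *)
Definition in_MnB (X : 'M[crossed act]_n) : Prop := exists Y, X = iota_mx Y.
Definition MnB (X : 'M[crossed act]_n) : 'M[B]_n := map_mx (@bpart _ _ _ act) X.

Definition conj_nabla (X : 'M[B]_n) : 'M[crossed act]_n :=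
  nabla *m iota_mx X *m nablaV.
Definition nabla_even (X : 'M[B]_n) : Prop := in_MnB (conj_nabla X).

(* [is_mxinv v (mxstar v)] is unitarity, and says that mxbar v is the transpose
   of the inverse of v; W^T is the transpose of the inverse of mxbar v. *)
Definition free_unitary_rel (F : 'M[B]_n) (C : bgStarAlgType act)
    (v : 'M[C]_n) : Prop :=
  [/\ forall i j, deg (gam i) (gam j) (v i j), is_mxinv v (mxstar v)
    & exists2 W, is_mxinv (mxbar v) W
      & map_mx rmap (MnB (conj_nabla F)) *m W^T = v *m map_mx smap F].

Definition is_free_unitary (F : 'M[B]_n) (A : bgStarAlgType act)
    (u : 'M[A]_n) : Prop :=
  free_unitary_rel F u /\
  forall (C : bgStarAlgType act) (v : 'M[C]_n), free_unitary_rel F v ->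
    exists f : bgMor A C,
      [/\ star_preserving f, map_mx f u = v
        & forall f' : bgMor A C, star_preserving f' -> map_mx f' u = v ->
            f' =1 f].

Definition is_fundamental_hopf (A : bgStarAlgType act) (u : 'M[A]_n)
    (H : hopfAlgebroid A) : Prop :=
  [/\ hopf_star H,
      forall i j, comult H (u i j) = \sum_k ftens (u i k) (u k j),
      forall i j, counit H (u i j) = if i == j then mono act (gam i) 1 else 0
    & is_mxinv u (map_mx (antipode H) u)].

End FreeUnitary.

(* Main.v *)
Require Import Defs.
From HB Require Import structures.
From mathcomp Require Import all_boot all_order all_algebra.
From mathcomp Require Import boolp reals complex monalg.
Set Implicit Arguments.
Unset Strict Implicit.
Unset Printing Implicit Defensive.
Import Order.TTheory GRing.Theory Num.Theory.
Local Open Scope ring_scope.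

(* A morphism f from A_u into a star-algebra C need not preserve the involution,
   but a |-> (f a, (f a^* )^* ) does, for the involution (x, y)^* = (y^*, x^* ) on
   C * C.  So the universal property, applied to C * C, also governs such
   morphisms: they are determined by f(u), because f(u^* ) is inverse to f(u),
   and the pair (nabla F^-k, nabla F^k) over the crossed product yields theta^(k)
   together with theta^(-k), so that theta is imaginary by construction.  The
   identities asserted for theta then only have to be compared on u.  As to S^2,
   inverting the defining relation of A_u under the antihomomorphism S gives
   S^2(u) = r(nabla F^-1 nabla^-1) u s(F), which is (a); since S^2(u) is the
   transpose of S(ubar), applying S once more gives (b). *)

(** * Matrices under algebra homomorphisms, and uniqueness of inverses *)

Section MapAlghom.
Variables (K : pzRingType) (A C : pzAlgType K) (f : A -> C).
Hypothesis fP : is_alghom f.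

Lemma map_alghomM m n p (X : 'M[A]_(m, n)) (Y : 'M[A]_(n, p)) :
  map_mx f (X *m Y) = map_mx f X *m map_mx f Y.
Proof.
apply/matrixP => i j; rewrite !mxE (alghom_sum fP); apply: eq_bigr => k _.
by rewrite !mxE (alghomM fP).
Qed.

Lemma map_alghom1 n : map_mx f (1%:M : 'M_n) = 1%:M.
Proof.
apply/matrixP => i j; rewrite !mxE.
by case: (i == j); rewrite ?(alghom1 fP) ?(alghom0 fP).
Qed.

Lemma map_is_mxinv n (X Y : 'M[A]_n) :
  is_mxinv X Y -> is_mxinv (map_mx f X) (map_mx f Y).
Proof. by case=> XY YX; split; rewrite -map_alghomM (XY, YX) map_alghom1. Qed.
End MapAlghom.

Lemma is_mxinv_inj (R : pzRingType) n (X Y Y' : 'M[R]_n) :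
  is_mxinv X Y -> is_mxinv X Y' -> Y = Y'.
Proof. by move=> [_ YX] [XY' _]; rewrite -[Y]mulmx1 -XY' mulmxA YX mul1mx. Qed.

(** * The product of an algebra with itself, with the swapped involution *)

Section StarSquare.
Variables (K : numClosedFieldType) (B : comStarAlgType K) (G : groupType).
Variables (act : starAction B G) (C : bgStarAlgType act).

Definition starsq : Type := (C * C)%type.
HB.instance Definition _ := GRing.PzRing.on starsq.

Definition dbscal (k : K) : starsq := (scal k, scal k).
Lemma dbscalD k l : dbscal (k + l) = dbscal k + dbscal l.
Proof. by rewrite /dbscal scalD. Qed.
Lemma dbscalM k l : dbscal (k * l) = dbscal k * dbscal l.
Proof. by rewrite /dbscal scalM. Qed.
Lemma dbscal1 : dbscal 1 = 1.
Proof. by rewrite /dbscal scal1. Qed.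
Lemma dbscalC k (x : starsq) : dbscal k * x = x * dbscal k.
Proof. by case: x => a c; congr pair; rewrite /= scalC. Qed.
HB.instance Definition _ :=
  isPzAlgebra.Build K starsq dbscalD dbscalM dbscal1 dbscalC.

Definition dbstar (x : starsq) : starsq := (star x.2, star x.1).
Lemma dbstarD x y : dbstar (x + y) = dbstar x + dbstar y.
Proof. by rewrite /dbstar !starD. Qed.
Lemma dbstarM x y : dbstar (x * y) = dbstar y * dbstar x.
Proof. by rewrite /dbstar !starM. Qed.
Lemma dbstar_scal k : dbstar (scal k) = scal k^*.
Proof. by rewrite /dbstar /= star_scal. Qed.
Lemma dbstarK : involutive dbstar.
Proof. by case=> a c; rewrite /dbstar /= !starK. Qed.
HB.instance Definition _ := hasStar.Build K starsq
  dbstarD dbstarM dbstar_scal dbstarK.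

Definition dbdeg (g h : G) (x : starsq) : Prop := deg g h x.1 /\ deg g h x.2.
Definition dbr (b : B) : starsq := (rmap b, rmap b).
Definition dbs (b : B) : starsq := (smap b, smap b).

Lemma dbdeg0 g h : dbdeg g h 0.
Proof. by split; apply: deg0. Qed.
Lemma dbdegD g h x y : dbdeg g h x -> dbdeg g h y -> dbdeg g h (x + y).
Proof. by move=> [d d'] [e e']; split; apply: degD. Qed.
Lemma dbdegZ g h (k : K) x : dbdeg g h x -> dbdeg g h (scal k * x).
Proof. by move=> [d d']; split; apply: degZ. Qed.
Lemma dbdeg_span (x : starsq) : exists2 t : seq starsq,
  forall y, y \in t -> exists g h, dbdeg g h y & x = \sum_(y <- t) y.
Proof.
case: x => a c; have [t th ->] := deg_span a; have [t' th' ->] := deg_span c.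
exists ([seq (y, 0) | y <- t] ++ [seq (0, y) | y <- t']).
  move=> y; rewrite mem_cat => /orP[] /mapP[z].
    by move=> /th[g [h d]] ->; exists g, h; split=> //; apply: deg0.
  by move=> /th'[g [h d]] ->; exists g, h; split=> //; apply: deg0.
rewrite big_cat !big_map /=.
have e1 (s : seq C) : \sum_(y <- s) ((y, 0) : starsq) = (\sum_(y <- s) y, 0).
  apply: (big_ind2 (fun (x : starsq) y => x = (y, 0))) => // _ y _ z -> ->.
  by congr pair; rewrite /= addr0.
have e2 (s : seq C) : \sum_(y <- s) ((0, y) : starsq) = (0, \sum_(y <- s) y).
  apply: (big_ind2 (fun (x : starsq) y => x = (0, y))) => // _ y _ z -> ->.
  by congr pair; rewrite /= addr0.
by rewrite e1 e2; congr pair; rewrite /= (addr0, add0r).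
Qed.
Lemma dbdeg_indep (s : seq (G * G)) (f : G * G -> starsq) : uniq s ->
    (forall d, d \in s -> dbdeg d.1 d.2 (f d)) ->
    \sum_(d <- s) f d = 0 -> forall d, d \in s -> f d = 0.
Proof.
move=> us fd fs d ds.
have fs1 : \sum_(d <- s) (f d).1 = 0.
  by rewrite -[RHS](congr1 fst fs) (big_morph fst (id1 := 0) (op1 := +%R)).
have fs2 : \sum_(d <- s) (f d).2 = 0.
  by rewrite -[RHS](congr1 snd fs) (big_morph snd (id1 := 0) (op1 := +%R)).
rewrite [f d]surjective_pairing.
rewrite (@deg_indep K B G act C s (fun d => (f d).1) us _ fs1 _ ds).
  rewrite (@deg_indep K B G act C s (fun d => (f d).2) us _ fs2 _ ds) //.
  by move=> e /fd[].
by move=> e /fd[].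
Qed.
Lemma dbdegM g h g' h' x y :
  dbdeg g h x -> dbdeg g' h' y -> dbdeg (g * g')%g (h * h')%g (x * y).
Proof. by move=> [d d'] [e e']; split; apply: degM. Qed.
Lemma dbr_hom : is_alghom dbr.
Proof.
split=> [x y|x y|k]; rewrite /dbr; first by rewrite (alghomD rmap_hom).
  by rewrite (alghomM rmap_hom).
by rewrite (alghom_scal rmap_hom).
Qed.
Lemma dbs_hom : is_alghom dbs.
Proof.
split=> [x y|x y|k]; rewrite /dbs; first by rewrite (alghomD smap_hom).
  by rewrite (alghomM smap_hom).
by rewrite (alghom_scal smap_hom).
Qed.
Lemma dbr_deg b : dbdeg 1%g 1%g (dbr b).
Proof. by split; apply: rmap_deg. Qed.
Lemma dbs_deg b : dbdeg 1%g 1%g (dbs b).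
Proof. by split; apply: smap_deg. Qed.
Lemma dbrsC b c : dbr b * dbs c = dbs c * dbr b.
Proof. by congr pair; rewrite /= rsmapC. Qed.
Lemma dbr_act g h x b : dbdeg g h x -> x * dbr b = dbr (act g b) * x.
Proof.
by case: x => a c [/= d d']; congr pair => /=; apply: rmap_act; eassumption.
Qed.
Lemma dbs_act g h x b : dbdeg g h x -> x * dbs b = dbs (act h b) * x.
Proof.
by case: x => a c [/= d d']; congr pair => /=; apply: smap_act; eassumption.
Qed.
HB.instance Definition _ := isBGAlgebra.Build K B G act starsq
  dbdeg0 dbdegD dbdegZ dbdeg_span dbdeg_indep dbdegM dbr_hom dbs_hom
  dbr_deg dbs_deg dbrsC dbr_act dbs_act.

Lemma dbdeg_star g h (x : starsq) :
  dbdeg g h x -> dbdeg g^-1%g h^-1%g (star x).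
Proof. by case=> d d'; split; apply: deg_star. Qed.
Lemma dbr_star b : star (dbr b) = dbr (star b).
Proof. by rewrite /dbr -!rmap_star. Qed.
Lemma dbs_star b : star (dbs b) = dbs (star b).
Proof. by rewrite /dbs -!smap_star. Qed.
HB.instance Definition _ := isBGStarAlgebra.Build K B G act starsq
  dbdeg_star dbr_star dbs_star.

Lemma starsq_fst_hom : is_alghom (fst : starsq -> C).
Proof. by []. Qed.
Lemma starsq_fst_deg g h (x : starsq) : deg g h x -> deg g h x.1.
Proof. by case. Qed.
Definition starsq_fst : bgMor starsq C :=
  BGMor starsq_fst_hom starsq_fst_deg (fun=> erefl) (fun=> erefl).

Lemma starsq_snd_hom : is_alghom (snd : starsq -> C).
Proof. by []. Qed.
Lemma starsq_snd_deg g h (x : starsq) : deg g h x -> deg g h x.2.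
Proof. by case. Qed.
Definition starsq_snd : bgMor starsq C :=
  BGMor starsq_snd_hom starsq_snd_deg (fun=> erefl) (fun=> erefl).

Section StarSquareMor.
Variables (A : bgStarAlgType act) (f : bgMor A C).
Let fh := mor_hom f.
Definition starsq_lift (a : A) : starsq := (f a, star (f (star a))).
Lemma starsq_lift_hom : is_alghom starsq_lift.
Proof.
split=> [x y|x y|k]; rewrite /starsq_lift.
- by rewrite starD !(alghomD fh) starD.
- by rewrite starM !(alghomM fh) starM.
- by rewrite star_scal !(alghom_scal fh) star_scal conjCK.
Qed.
Lemma starsq_lift_deg g h x : deg g h x -> deg g h (starsq_lift x).
Proof.
move=> d; split; rewrite /starsq_lift /=; first exact: mor_deg.
by rewrite -(invgK g) -(invgK h); apply/deg_star/mor_deg/deg_star.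
Qed.
Lemma starsq_lift_r b : starsq_lift (rmap b) = rmap b.
Proof. by rewrite /starsq_lift rmap_star !mor_r rmap_star starK. Qed.
Lemma starsq_lift_s b : starsq_lift (smap b) = smap b.
Proof. by rewrite /starsq_lift smap_star !mor_s smap_star starK. Qed.
Definition starsq_mor : bgMor A starsq :=
  BGMor starsq_lift_hom starsq_lift_deg starsq_lift_r starsq_lift_s.
Lemma starsq_mor_star : star_preserving starsq_mor.
Proof.
move=> a; rewrite /= /starsq_lift starK.
by rewrite [RHS]/star /= /dbstar /= starK.
Qed.
End StarSquareMor.
End StarSquare.

(** * Composition of morphisms, the co-opposite as a functor, and the antipode of the crossed
    product *)

Section MorTheory.
Variables (K : numClosedFieldType) (B : comStarAlgType K) (G : groupType).
Variable act : starAction B G.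

Section Comp.
Variables (A C D : bgAlgType act) (g : bgMor C D) (f : bgMor A C).
Lemma compmor_hom : is_alghom (g \o f).
Proof.
have [fh gh] := (mor_hom f, mor_hom g); split=> [x y|x y|k] /=.
- by rewrite (alghomD fh) (alghomD gh).
- by rewrite (alghomM fh) (alghomM gh).
- by rewrite (alghom_scal fh) (alghom_scal gh).
Qed.
Lemma compmor_deg h k x : deg h k x -> deg h k ((g \o f) x).
Proof. by move=> d; do 2!apply: mor_deg. Qed.
Lemma compmor_r b : (g \o f) (rmap b) = rmap b.
Proof. by rewrite /= !mor_r. Qed.
Lemma compmor_s b : (g \o f) (smap b) = smap b.
Proof. by rewrite /= !mor_s. Qed.
Definition compmor : bgMor A D :=
  BGMor compmor_hom compmor_deg compmor_r compmor_s.
End Comp.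

Section CoopMor.
Variables (A C : bgAlgType act) (f : bgMor A C).
Let fh := mor_hom f.
Definition coop_fun (a : coop A) : coop C := f (a : A).
Lemma coop_fun_hom : is_alghom coop_fun.
Proof.
split=> [x y|x y|k]; first exact: (alghomD fh).
  exact: (alghomM fh).
exact: (alghom_scal fh).
Qed.
Lemma coop_fun_deg g h x : deg g h x -> deg g h (coop_fun x).
Proof. exact: (mor_deg f). Qed.
Lemma coop_fun_r b : coop_fun (rmap b) = rmap b.
Proof. exact: (mor_s f). Qed.
Lemma coop_fun_s b : coop_fun (smap b) = smap b.
Proof. exact: (mor_r f). Qed.
Definition coop_mor : bgMor (coop A) (coop C) :=
  BGMor coop_fun_hom coop_fun_deg coop_fun_r coop_fun_s.
End CoopMor.

Section UncoopMor.
Variable A : bgAlgType act.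
(** Composing S with itself lands in [coop (coop A)]; this identification turns it into a morphism
    from A to A, since swapping and inverting the degrees twice restores them. *)
Definition uncoop_fun (a : coop (coop A)) : A := a.
Lemma uncoop_fun_hom : is_alghom uncoop_fun.
Proof. by []. Qed.
Lemma uncoop_fun_deg g h x : deg g h x -> deg g h (uncoop_fun x).
Proof. by rewrite /deg /= /codeg /deg /= /codeg !invgK. Qed.
Definition uncoop : bgMor (coop (coop A)) A :=
  BGMor uncoop_fun_hom uncoop_fun_deg (fun=> erefl) (fun=> erefl).
End UncoopMor.

Section CoopStar.
Variable A : bgStarAlgType act.
(** The compatibility of characters with S is an equation between morphisms into
    [coop (crossed act)]. The universal property applies to it only if that target carries an
    involution. *)
Definition costar (a : coop A) : coop A := star (a : A).
Lemma costarD x y : costar (x + y) = costar x + costar y.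
Proof. exact: starD. Qed.
Lemma costarM x y : costar (x * y) = costar y * costar x.
Proof. exact: (@starM _ A). Qed.
Lemma costar_scal k : costar (scal k) = scal k^*.
Proof. exact: star_scal. Qed.
Lemma costarK : involutive costar.
Proof. exact: starK. Qed.
HB.instance Definition _ := hasStar.Build K (coop A)
  costarD costarM costar_scal costarK.
Lemma codeg_star g h (x : coop A) :
  deg g h x -> deg g^-1%g h^-1%g (star x).
Proof. exact: (@deg_star _ _ _ _ A). Qed.
Lemma cor_star b : star (rmap b : coop A) = rmap (star b).
Proof. exact: (@smap_star _ _ _ _ A). Qed.
Lemma cos_star b : star (smap b : coop A) = smap (star b).
Proof. exact: (@rmap_star _ _ _ _ A). Qed.
HB.instance Definition _ := isBGStarAlgebra.Build K B G act (coop A)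
  codeg_star cor_star cos_star.
End CoopStar.

Section CrantipMor.
Let crantip_f g b := mono act g^-1%g (act g^-1%g b).
Let crantip_D g b c : crantip_f g (b + c) = crantip_f g b + crantip_f g c.
Proof. by rewrite /crantip_f (alghomD (act_hom act _)) monoD. Qed.
Lemma crantipE g b :
  crantip (mono act g b) = mono act g^-1%g (act g^-1%g b).
Proof. exact: (@crext_mono _ _ _ act _ crantip_f crantip_D). Qed.
Lemma crantipD (x y : crossed act) : crantip (x + y) = crantip x + crantip y.
Proof. exact: (@crextD _ _ _ act _ crantip_f crantip_D). Qed.
Lemma crantip0 : crantip (0 : crossed act) = 0.
Proof. exact: (@crext0 _ _ _ act _ crantip_f crantip_D). Qed.
Lemma crantipM (x y : crossed act) : crantip (x * y) = crantip y * crantip x.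
Proof.
elim/crossed_ind: x => [g b|x x' IH IH']; last first.
  by rewrite mulrDl !crantipD mulrDr IH IH'.
elim/crossed_ind: y => [h c|y y' IH IH']; last first.
  by rewrite mulrDr !crantipD mulrDl IH IH'.
rewrite monoM !crantipE monoM invgM (alghomM (act_hom act _)) !act_mul.
by rewrite -(act_mul act g^-1%g g) mulVg act_1 mulrC.
Qed.
(** Seen as a map into the opposite algebra, the anti-automorphism is a morphism and can be composed
    with a character. *)
Definition crantip_coop (x : crossed act) : coop (crossed act) := crantip x.
Lemma crantip_hom : is_alghom crantip_coop.
Proof.
split=> [x y|x y|k]; first exact: crantipD.
  exact: crantipM.
by rewrite /crantip_coop crantipE invg1 act_1.
Qed.
Lemma crantip_deg g h x : deg g h x -> deg g h (crantip_coop x).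
Proof.
rewrite /crantip_coop; case=> b ->; case: (g =P h) => [->|_].
  by rewrite crantipE; exists (act h^-1%g b); rewrite eqxx.
by rewrite crantip0; apply: deg0.
Qed.
Lemma crantip_iota b : crantip (Defs.iota act b) = Defs.iota act b.
Proof. by rewrite crantipE invg1 act_1. Qed.
Definition crantip_mor : bgMor (crossed act) (coop (crossed act)) :=
  BGMor crantip_hom crantip_deg crantip_iota crantip_iota.
End CrantipMor.
End MorTheory.

(** * Uniqueness for morphisms that may not preserve the involution *)

Section Universal.
Variables (K : numClosedFieldType) (B : comStarAlgType K) (G : groupType).
Variables (act : starAction B G) (n : nat) (gam : 'I_n -> G) (F : 'M[B]_n).

Lemma free_unitary_rel_mor (A C : bgStarAlgType act) (f : bgMor A C)
    (u : 'M[A]_n) : star_preserving f ->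
  free_unitary_rel gam F u -> free_unitary_rel gam F (map_mx f u).
Proof.
have fh := mor_hom f; move=> fs [du uU [W uW eW]].
have fbar : mxbar (map_mx f u) = map_mx f (mxbar u).
  by apply/matrixP => i j; rewrite !mxE fs.
split=> [i j||]; first by rewrite mxE; apply: mor_deg.
  by rewrite /mxstar fbar map_trmx; apply: map_is_mxinv.
exists (map_mx f W); first by rewrite fbar; apply: map_is_mxinv.
have er (X : 'M[B]_n) : map_mx rmap X = map_mx f (map_mx rmap X).
  by apply/matrixP => i j; rewrite !mxE mor_r.
have es (X : 'M[B]_n) : map_mx smap X = map_mx f (map_mx smap X).
  by apply/matrixP => i j; rewrite !mxE mor_s.
by rewrite er es map_trmx -!(map_alghomM fh) eW.
Qed.

(** All later identities between morphisms on A are reduced to the generators by this. Both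
    [starsq_mor f] and [starsq_mor g] preserve the involution, so they coincide once they agree on
    [u]; then their first components do. *)
Lemma free_unitary_ext (A C : bgStarAlgType act) (u : 'M[A]_n)
    (f g : bgMor A C) : is_free_unitary gam F u ->
  map_mx f u = map_mx g u -> f =1 g.
Proof.
move=> [ru univ] fg; have [_ uU _] := ru.
(* f(u^* ) and g(u^* ) are both inverse to f(u) = g(u). *)
have fgU : map_mx f (mxstar u) = map_mx g (mxstar u).
  apply: (@is_mxinv_inj _ _ (map_mx f u)).
    exact: map_is_mxinv (mor_hom f) _ _ _ uU.
  by rewrite fg; exact: map_is_mxinv (mor_hom g) _ _ _ uU.
have := univ _ _ (free_unitary_rel_mor (starsq_mor_star f) ru).
move=> [h [_ _ huniq]] a.
have ef := huniq _ (starsq_mor_star f) erefl a.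
have eg := huniq _ (starsq_mor_star g) _ a.
suff /eg e : map_mx (starsq_mor g) u = map_mx (starsq_mor f) u.
  by have := congr1 fst (etrans ef (esym e)).
(* The second component at (i, j) involves [f (star (u i j))], which is the entry (j, i) of the
   image of [mxstar u]; hence the swapped indices for [fgU]. *)
apply/matrixP => i j; rewrite !mxE /= /starsq_lift.
have /matrixP/(_ i j) := fg; have /matrixP/(_ j i) := fgU; rewrite !mxE.
by move=> -> ->.
Qed.
End Universal.

(** * Integer powers of an invertible matrix *)

Section MxPowz.
Variables (R : pzRingType) (n : nat) (X Y : 'M[R]_n).
Hypothesis XY : is_mxinv X Y.

Lemma mxpowz_succ k : mxpowz X Y (k + 1) = mxpowz X Y k *m X.
Proof.
case: k => [m|[|m]]; first by rewrite -PoszD addn1 /= exprSr.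
  (* Here k = -1, encoded as [Negz 0]: the exponent crosses zero and the claim is 1 = YX. *)
  exact: esym (proj2 XY).
have -> : Negz m.+1 + 1 = Negz m by rewrite !NegzE -[in LHS]addn1 PoszD opprD subrK.
by rewrite /= [Y ^+ m.+2]exprSr -mulmxA (proj2 XY) mulmx1.
Qed.

Lemma mxpowzD k l : mxpowz X Y (k + l) = mxpowz X Y k *m mxpowz X Y l.
Proof.
elim/int_ind: l => [|l IH|l IH]; first by rewrite addr0 [RHS]mulr1.
  by rewrite -[l.+1]addn1 PoszD addrA !mxpowz_succ IH mulmxA.
have e m : mxpowz X Y (m - 1) = mxpowz X Y m *m Y.
  by rewrite -{2}[m](subrK 1) mxpowz_succ -mulmxA (proj1 XY) mulmx1.
by rewrite -[l.+1]addn1 PoszD opprD addrA !e IH mulmxA.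
Qed.

Lemma mxpowzN k : is_mxinv (mxpowz X Y k) (mxpowz X Y (- k)).
Proof. by split; rewrite -mxpowzD ?subrr ?addNr. Qed.

Lemma mxpowz_ind (P : 'M[R]_n -> Prop) k : P 1%:M -> P X -> P Y ->
  (forall V W, P V -> P W -> P (V *m W)) -> P (mxpowz X Y k).
Proof.
move=> P1 PX PY PM; have Pexp V m : P V -> P (V ^+ m).
  by move=> PV; elim: m => [//|m IH]; rewrite exprS; apply: PM.
by case: k => m /=; apply: Pexp.
Qed.
End MxPowz.

(** * Adjoints of matrices and of their powers *)

Section MxStar.
Variables (K : numClosedFieldType) (A : starAlgType K) (n : nat).

Lemma mxstarM (X Y : 'M[A]_n) : mxstar (X *m Y) = mxstar Y *m mxstar X.
Proof.
apply/matrixP => i j; rewrite !mxE star_sum; apply: eq_bigr => k _.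
by rewrite !mxE starM.
Qed.

Lemma mxstar1 : mxstar (1%:M : 'M[A]_n) = 1%:M.
Proof.
apply/matrixP => i j; rewrite !mxE eq_sym.
by case: (i == j); rewrite ?star1 ?star0.
Qed.

Lemma mxstar_mxinv (X Y : 'M[A]_n) :
  is_mxinv X Y -> is_mxinv (mxstar X) (mxstar Y).
Proof. by move=> [XY YX]; split; rewrite -mxstarM (XY, YX) mxstar1. Qed.

Lemma mxstar_powz (X Y : 'M[A]_n) k : is_mxinv X Y ->
  mxstar X = X -> mxstar (mxpowz X Y k) = mxpowz X Y k.
Proof.
move=> XY sX; have sY : mxstar Y = Y.
  by apply: (is_mxinv_inj _ XY); rewrite -{1}sX; apply: mxstar_mxinv.
have sexp (V : 'M[A]_n) m : mxstar V = V -> mxstar (V ^+ m) = V ^+ m.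
  move=> sV; elim: m => [|m IH]; first exact: mxstar1.
  by rewrite {1}exprS mxstarM sV IH exprSr.
by case: k => m /=; apply: sexp.
Qed.
End MxStar.

(** * Even matrices and conjugation by nabla *)

Section Even.
Variables (K : numClosedFieldType) (B : comStarAlgType K) (G : groupType).
Variables (act : starAction B G) (n : nat) (gam : 'I_n -> G).
Implicit Types X Y : 'M[B]_n.

(** The working form of evenness: the (i, j) entry of nabla X nabla^-1 is a multiple of gam_i
    gam_j^-1, so it lies in B only if this group element is trivial or the entry vanishes. *)
Definition block_diag X : Prop := forall i j, gam i != gam j -> X i j = 0.

Lemma block_diag_or X i j : block_diag X -> gam i = gam j \/ X i j = 0.
Proof.
by move=> eX; have [|/eqP/eX] := gam i =P gam j; [left|right].
Qed.

Lemma block_diagM X Y : block_diag X -> block_diag Y -> block_diag (X *m Y).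
Proof.
move=> eX eY i j ij; rewrite mxE big1 // => k _.
have [ik|->] := block_diag_or i k eX; last exact: mul0r.
by rewrite (eY k) ?mulr0 // -ik.
Qed.

Lemma block_diag1 : block_diag 1%:M.
Proof. by move=> i j; rewrite mxE; case: (i =P j) => // ->; rewrite eqxx. Qed.

(** Let Y' be Y with the entries outside the blocks replaced by 0. As X does not mix blocks, XY' is
    the block part of XY = 1, so Y' is an inverse as well and equals Y. *)
Lemma block_diag_inv X Y : is_mxinv X Y -> block_diag X -> block_diag Y.
Proof.
move=> XY eX; pose Y' := \matrix_(i, j) (if gam i == gam j then Y i j else 0).
suff -> : Y = Y' by move=> i j; rewrite mxE => /negPf ->.
have XY' : X *m Y' = 1%:M.
  apply/matrixP => i j; transitivity (if gam i == gam j then (X *m Y) i j else 0).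
    case: eqP => ij; rewrite !mxE; last rewrite big1 //.
      apply: eq_bigr => k _; rewrite mxE -ij.
      by have [->|->] := block_diag_or i k eX; rewrite ?eqxx ?mul0r.
    move=> k _; rewrite mxE.
    have [<-|->] := block_diag_or i k eX; last exact: mul0r.
    by case: eqP => // _; rewrite mulr0.
  by rewrite (proj1 XY) mxE; case: (i =P j) => [->|]; rewrite ?eqxx ?if_same.
by rewrite -[RHS]mul1mx -(proj2 XY) -mulmxA XY' mulmx1.
Qed.

Lemma block_diag_powz X Y k : is_mxinv X Y -> block_diag X ->
  block_diag (mxpowz X Y k).
Proof.
move=> XY eX; apply: mxpowz_ind => //; first exact: block_diag1.
  exact: block_diag_inv eX.
exact: block_diagM.
Qed.

Lemma nablaM_E X i j :
  (nabla act gam *m iota_mx act X) i j = mono act (gam i) (act (gam i) (X i j)).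
Proof. by rewrite mul_diag_mx !mxE monoM mulg1 mul1r. Qed.

Lemma conj_nablaE X i j : conj_nabla act gam X i j
  = mono act (gam i * (gam j)^-1)%g (act (gam i) (X i j)).
Proof.
rewrite /conj_nabla mul_mx_diag mxE nablaM_E !mxE monoM.
by rewrite (alghom1 (act_hom act _)) mulr1.
Qed.

(** For even X, this is nabla X nabla^-1 as a matrix over B. *)
Definition twist X : 'M[B]_n := \matrix_(i, j) act (gam i) (X i j).

Lemma conj_nabla_twist X : block_diag X ->
  conj_nabla act gam X = iota_mx act (twist X).
Proof.
move=> eX; apply/matrixP => i j; rewrite conj_nablaE !mxE.
have [<-|->] := block_diag_or i j eX; first by rewrite mulgV.
by rewrite (alghom0 (act_hom act _)) /Defs.iota !mono0.
Qed.

Lemma iota_mxK X : MnB (iota_mx act X) = X.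
Proof. by apply/matrixP => i j; rewrite !mxE /bpart mcoeffUU. Qed.

Lemma MnB_conj_nabla X : block_diag X -> MnB (conj_nabla act gam X) = twist X.
Proof. by move=> eX; rewrite conj_nabla_twist // iota_mxK. Qed.

(** Compare coefficients at gam_i gam_j^-1: a matrix over B is supported at the unit, so gam_i(x_ij)
    = 0 when gam_i and gam_j differ, and gam_i acts invertibly. *)
Lemma nabla_evenP X : nabla_even act gam X -> block_diag X.
Proof.
move=> [Y /matrixP eY] i j ij; have := eY i j; rewrite conj_nablaE mxE.
move=> /(congr1 (mcoeff (gam i * (gam j)^-1)%g)).
rewrite mcoeffUU mcoeffU; case: eqP => [e|_].
  by case/eqP: ij; rewrite -[LHS](mulgVK (gam j)) -e mul1g.
rewrite mulr0n => /(congr1 (act (gam i)^-1%g)).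
by rewrite (alghom0 (act_hom act _)) -act_mul mulVg act_1.
Qed.

(** In the k-th summand [twist Y] applies gam_k where gam_i is wanted; if these differ, then x_ik =
    0. *)
Lemma twistM X Y : block_diag X -> twist (X *m Y) = twist X *m twist Y.
Proof.
move=> eX; apply/matrixP => i j; rewrite !mxE (alghom_sum (act_hom act _)).
apply: eq_bigr => k _; rewrite !mxE (alghomM (act_hom act _)).
have [->//|->] := block_diag_or i k eX.
by rewrite (alghom0 (act_hom act _)) !mul0r.
Qed.

Lemma twist1 : twist 1%:M = 1%:M.
Proof.
apply/matrixP => i j; rewrite !mxE.
by case: (i == j); rewrite ?(alghom1 (act_hom act _)) ?(alghom0 (act_hom act _)).
Qed.

Lemma twist_mxinv X Y : is_mxinv X Y -> block_diag X ->
  is_mxinv (twist X) (twist Y).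
Proof.
move=> XY eX; have eY := block_diag_inv XY eX; case: XY => XY YX.
by split; rewrite -twistM // (XY, YX) twist1.
Qed.

Lemma nabla_mxinv : is_mxinv (nabla act gam) (nablaV act gam).
Proof.
by split; apply/matrixP => i j; rewrite mul_diag_mx !mxE;
  (case: eqP => [_|_]; rewrite ?mulr0 // !mulr1n monoM mul1r);
  rewrite ?(mulgV, mulVg) ?(alghom1 (act_hom act _)).
Qed.

Lemma iota_mxM X Y : iota_mx act (X *m Y) = iota_mx act X *m iota_mx act Y.
Proof. exact: map_alghomM (iota_hom act) _ _ _ _ _. Qed.

Lemma iota_mx1 : iota_mx act (1%:M : 'M_n) = 1%:M.
Proof. exact: map_alghom1 (iota_hom act) _. Qed.

(** The adjoint of gam_i x_ij is x_ij^* gam_i^-1, and x_ij^* = x_ji. *)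
Lemma mxbar_nablaM X : mxstar X = X ->
  mxbar (nabla act gam *m iota_mx act X) = (iota_mx act X *m nablaV act gam)^T.
Proof.
move=> sX; apply/matrixP => i j.
rewrite mxE nablaM_E mxE mul_mx_diag !mxE monoM mul1g act_1 mulr1.
rewrite [LHS]crstarE act_star -act_mul mulVg act_1.
by rewrite -[X in RHS]sX !mxE.
Qed.

(* Entrywise the transpose is [x_ji gam_i^-1], and [gam_i = gam_j] if [x_ji]
   does not vanish. *)
Lemma tr_iota_nablaV X : block_diag X ->
  (iota_mx act X *m nablaV act gam)^T = (iota_mx act X)^T *m nablaV act gam.
Proof.
move=> eX; apply/matrixP => i j; rewrite mxE !mul_mx_diag !mxE !monoM.
have [->//|->] := block_diag_or j i eX.
by rewrite !mul0r !mono0.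
Qed.

(** Over a noncommutative ring, transposing need not respect inverses. Here it does: in every
    nonzero summand the group elements cancel, and the remaining coefficients commute in B. *)
Lemma nabla_tr_mxinv X Y : is_mxinv X Y -> block_diag X ->
  is_mxinv (iota_mx act X *m nablaV act gam)^T (nabla act gam *m iota_mx act Y)^T.
Proof.
move=> XY eX; have eY := block_diag_inv XY eX; case: XY => XY YX; split.
  transitivity (iota_mx act (Y *m X)^T); last by rewrite YX trmx1 iota_mx1.
  apply/matrixP => i j; rewrite !mxE.
  rewrite (alghom_sum (iota_hom act)); apply: eq_bigr => k _.
  rewrite mxE mul_mx_diag mxE [X in _ * X]mxE nablaM_E !mxE !monoM.
  rewrite mul1g act_1 mulr1 -act_mul.
  have [ki|->] := block_diag_or k i eX; last first.
    by rewrite mulr0 mul0r /Defs.iota !mono0.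
  have [->|->] := block_diag_or j k eY; last first.
    by rewrite (alghom0 (act_hom act _)) mulr0 mul0r /Defs.iota !mono0.
  by rewrite ki mulVg act_1 mulrC.
(* In this order the k-th summand is gam_k y_ki x_jk gam_k^-1, and conjugation by gam_k = gam_j
   produces the twist. *)
transitivity (iota_mx act (twist (X *m Y))^T); last first.
  by rewrite XY twist1 trmx1 iota_mx1.
apply/matrixP => i j; rewrite !mxE (alghom_sum (act_hom act _)).
rewrite (alghom_sum (iota_hom act)); apply: eq_bigr => k _.
rewrite mxE nablaM_E [X in _ * X]mxE mul_mx_diag !mxE !monoM.
rewrite mul1g act_1 mulr1 mulgV (alghomM (act_hom act _)).
have [->|->] := block_diag_or j k eX; first by rewrite mulrC.
by rewrite !(alghom0 (act_hom act _)) mulr0 mul0r.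
Qed.
End Even.

(** * Matrices over the product algebra *)

Section PairMx.
Variables (K : numClosedFieldType) (B : comStarAlgType K) (G : groupType).
Variables (act : starAction B G) (C : bgStarAlgType act) (n : nat).

Definition pair_mx (X Y : 'M[C]_n) : 'M[starsq C]_n :=
  \matrix_(i, j) (X i j, Y i j).

Lemma pair_mxM X Y X' Y' :
  pair_mx X Y *m pair_mx X' Y' = pair_mx (X *m X') (Y *m Y').
Proof.
apply/matrixP => i j; rewrite !mxE.
apply: (big_rec3 (fun x y (z : starsq C) => z = (x, y))) => // k x y z _ ->.
by rewrite !mxE.
Qed.

Lemma pair_mx1 : pair_mx 1%:M 1%:M = 1%:M.
Proof. by apply/matrixP => i j; rewrite !mxE; case: (i == j). Qed.

Lemma pair_mx_mxinv X Y X' Y' : is_mxinv X X' -> is_mxinv Y Y' ->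
  is_mxinv (pair_mx X Y) (pair_mx X' Y').
Proof.
by move=> [a b] [a' b']; split; rewrite pair_mxM (a, b) (a', b') pair_mx1.
Qed.

Lemma mxbar_pair X Y : mxbar (pair_mx X Y) = pair_mx (mxbar Y) (mxbar X).
Proof. by apply/matrixP => i j; rewrite !mxE. Qed.
End PairMx.

(** * Values of the canonical maps on elementary tensors *)

Section FiberTens.
Variables (K : numClosedFieldType) (B : comStarAlgType K) (G : groupType).
Variable act : starAction B G.

Lemma fib_deg (A C : bgAlgType act) g h k (a : A) (c : C) :
  deg g h a -> deg h k c -> fib (a, c).
Proof. by move=> d d'; apply/asboolP; exists g, h, k. Qed.

Lemma fmor_tens (A C A' C' : bgAlgType act) (f : bgMor A A') (g : bgMor C C')
    (a : A) (c : C) : fib (a, c) -> fmor f g (ftens a c) = ftens (f a) (g c).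
Proof. by move=> ac; rewrite /= /ftens fmapE //= ac. Qed.

Lemma flift_tens (A C D : bgAlgType act) (f : A -> C -> D)
    (fDl : forall a a' c, f (a + a') c = f a c + f a' c)
    (fDr : forall a c c', f a (c + c') = f a c + f a c')
    (fM : forall p q : A * C, fib p -> fib q ->
       f (p.1 * q.1) (p.2 * q.2) = f p.1 p.2 * f q.1 q.2)
    (fZ : forall (k : K) a c, f (scal k * a) c = f a (scal k * c))
    (fI : forall b, f (smap b) 1 = f 1 (rmap b)) a c :
  fib (a, c) -> flift f (ftens a c) = f a c.
Proof.
move=> ac; rewrite /ftens fliftE //= ?ac ?big_seq1 // => p q b fp fq.
(* The ideal relation between p and q factors through (s(b), 1) on one side and (1, r(b)) on the
   other; by multiplicativity it reduces to [fI]. *)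
have fsb : fib (smap b : A, 1 : C) by apply: fib_deg (smap_deg b) (deg1 C).
have frb : fib (1 : A, rmap b : C) by apply: fib_deg (deg1 A) (rmap_deg b).
rewrite -{1}[p.2]mulr1 -{2}[p.1]mulr1.
rewrite (fM (pmul p (_, _)) q (fibM fp fsb) fq).
rewrite (fM (pmul p (_, _)) q (fibM fp frb) fq) /=.
by rewrite (fM p (_, _) fp fsb) (fM p (_, _) fp frb) /= fI.
Qed.

Lemma lunit_tens (A : bgAlgType act) (x : crossed act) (a : A) :
  fib (x, a) -> lunit A (ftens x a) = rhat A x * a.
Proof.
exact: flift_tens (@lunit_Dl _ _ _ _ A) (@lunit_Dr _ _ _ _ A)
  (@lunit_M _ _ _ _ A) (@lunit_Z _ _ _ _ A) (@lunit_I _ _ _ _ A) _ _.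
Qed.

Lemma runit_tens (A : bgAlgType act) (a : A) (x : crossed act) :
  fib (a, x) -> runit A (ftens a x) = shat A x * a.
Proof.
exact: flift_tens (@runit_Dl _ _ _ _ A) (@runit_Dr _ _ _ _ A)
  (@runit_M _ _ _ _ A) (@runit_Z _ _ _ _ A) (@runit_I _ _ _ _ A) _ _.
Qed.

Lemma rhat_mono (A : bgAlgType act) g b : rhat A (mono act g b) = rmap b.
Proof. exact: hatE (@rmap_hom _ _ _ _ A) _ _. Qed.

Lemma shat_mono (A : bgAlgType act) g b : shat A (mono act g b) = smap b.
Proof. exact: hatE (@smap_hom _ _ _ _ A) _ _. Qed.
End FiberTens.

(** * The antipode on matrices, and its square as a morphism *)

Section Antipode.
Variables (K : numClosedFieldType) (B : comStarAlgType K) (G : groupType).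
Variables (act : starAction B G) (A : bgAlgType act) (H : hopfAlgebroid A).
Local Notation S := (antipode H).

Let Sh := mor_hom (antipode_mor H).
Lemma antipodeD x y : S (x + y) = S x + S y.
Proof. exact: (alghomD Sh). Qed.
Lemma antipodeM x y : S (x * y) = S y * S x.
Proof. exact: (alghomM Sh). Qed.
Lemma antipode_r b : S (rmap b) = smap b.
Proof. exact: (mor_r (antipode_mor H)). Qed.
Lemma antipode_s b : S (smap b) = rmap b.
Proof. exact: (mor_s (antipode_mor H)). Qed.
Lemma antipode_sum I (r : seq I) (f : I -> A) :
  S (\sum_(i <- r) f i) = \sum_(i <- r) S (f i).
Proof. exact: (big_morph S antipodeD (alghom0 Sh)). Qed.

(** S reverses products of entries; the transposes make up for this with a reversed matrix
    product. *)
Lemma antipode_mxM n (X Y : 'M[A]_n) :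
  (map_mx S (X *m Y))^T = (map_mx S Y)^T *m (map_mx S X)^T.
Proof.
apply/matrixP => i j; rewrite !mxE antipode_sum; apply: eq_bigr => k _.
by rewrite !mxE antipodeM.
Qed.

Lemma antipode_mxinv n (X Y : 'M[A]_n) :
  is_mxinv X Y -> is_mxinv (map_mx S X)^T (map_mx S Y)^T.
Proof.
have e1 : (map_mx S (1%:M : 'M_n))^T = 1%:M.
  apply/matrixP => i j; rewrite !mxE eq_sym.
  by case: (i == j); [exact: alghom1 Sh|exact: alghom0 Sh].
by case=> XY YX; split; rewrite -antipode_mxM (XY, YX).
Qed.

Definition antipode2 : bgMor A A :=
  compmor (uncoop A) (compmor (coop_mor (antipode_mor H)) (antipode_mor H)).
End Antipode.

(** * The square of the antipode on the generators: parts (a) and (b) *)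

Section Intertwiners.
Variables (K : numClosedFieldType) (B : comStarAlgType K) (G : groupType).
Variables (act : starAction B G) (n : nat) (gam : 'I_n -> G).
Variables (F Finv : 'M[B]_n) (A : bgStarAlgType act) (u : 'M[A]_n).
Variable H : hopfAlgebroid A.
Hypothesis F_inv : is_mxinv F Finv.
Hypothesis eF : block_diag gam F.
Hypothesis u_rel : free_unitary_rel gam F u.
Hypothesis Su_inv : is_mxinv u (map_mx (antipode H) u).
Local Notation S := (antipode H).
Local Notation tw := (twist act gam).
Local Notation rm := (map_mx rmap).
Local Notation sm := (map_mx smap).

Let eFinv : block_diag gam Finv := block_diag_inv F_inv eF.

Lemma antipode_u : map_mx S u = mxstar u.
Proof. by have [_ uU _] := u_rel; apply: is_mxinv_inj Su_inv uU. Qed.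

(** S reverses the three factors, exchanges r and s, and sends [u] to [mxstar u], whose transpose is
    [mxbar u]. *)
Lemma antipode_rus (X Y : 'M[B]_n) :
  (map_mx S (rm X *m u *m sm Y))^T = rm Y^T *m mxbar u *m sm X^T.
Proof.
have er (Z : 'M[B]_n) : map_mx S (rm Z) = sm Z.
  by apply/matrixP => i j; rewrite !mxE antipode_r.
have es (Z : 'M[B]_n) : map_mx S (sm Z) = rm Z.
  by apply/matrixP => i j; rewrite !mxE antipode_s.
rewrite !antipode_mxM er es antipode_u !map_trmx mulmxA; congr (_ *m _ *m _).
exact: trmxK.
Qed.

(** The entry [star (u l k)] has degree (gam_l^-1, gam_k^-1). Moving s(gam_i(x_ik)) to its left
    gives s(x_ik), because gam_i = gam_k unless x_ik = 0; moving r(y_lj) to its right gives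
    r(gam_l(y_lj)). *)
Lemma ru_twist (X Y : 'M[B]_n) : block_diag gam X ->
  (rm Y^T *m mxbar u *m sm (tw X)^T)^T = sm X *m mxstar u *m rm (tw Y).
Proof.
have [du _ _] := u_rel; move=> eX; apply/matrixP => i j; rewrite !mxE.
under eq_bigr do rewrite mxE mulr_suml.
rewrite exchange_big; apply: eq_bigr => l _ /=.
rewrite [(_ *m mxstar u) i l]mxE mulr_suml; apply: eq_bigr => k _ /=; rewrite !mxE.
have d := deg_star _ _ _ (du l k).
rewrite -mulrA (smap_act _ _ _ _ d).
have -> : act (gam k)^-1%g (act (gam i) (X i k)) = X i k.
  have [->|->] := block_diag_or i k eX; first by rewrite -act_mul mulVg act_1.
  by rewrite !(alghom0 (act_hom act _)).
rewrite mulrA rsmapC -!mulrA (rmap_act _ _ _ _ d).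
by rewrite -act_mul mulVg act_1.
Qed.

(** This is the defining relation solved for the transpose of the inverse of [mxbar u]. *)
Lemma bar_inv : is_mxinv (mxbar u) (rm (tw Finv) *m u *m sm F)^T.
Proof.
have [_ _ [W uW]] := u_rel; rewrite MnB_conj_nabla // => eW.
suff <- : W^T = rm (tw Finv) *m u *m sm F by rewrite trmxK.
rewrite -mulmxA -eW mulmxA -(map_alghomM rmap_hom).
have [_ ->] := twist_mxinv act F_inv eF.
by rewrite (map_alghom1 rmap_hom) mul1mx.
Qed.

Lemma antipode2_bar : map_mx S (map_mx S u) = (map_mx S (mxbar u))^T.
Proof. by rewrite antipode_u /mxstar map_trmx. Qed.

(** Let Q be the right-hand side. Applying S to [bar_inv] shows that S^2(u) is inverse to S(Q), and
    S(Q) = s(F^-1) u^* r([tw F]) is visibly inverse to Q because u is unitary. *)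
Lemma antipode2_u : map_mx S (map_mx S u) = rm (tw Finv) *m u *m sm F.
Proof.
rewrite antipode2_bar; set Q := rm _ *m u *m _.
have sQ : (map_mx S Q^T)^T = sm Finv *m mxstar u *m rm (tw F).
  by rewrite map_trmx trmxK -[LHS]trmxK antipode_rus ru_twist.
have [_ [uU Uu] _] := u_rel.
have [FF' F'F] := F_inv.
have [tFF' tF'F] := twist_mxinv act F_inv eF.
have i1 : is_mxinv (map_mx S Q^T)^T (map_mx S (mxbar u))^T.
  by case: (antipode_mxinv H bar_inv).
apply: is_mxinv_inj i1 _; rewrite sQ /Q; split.
  rewrite -!mulmxA (mulmxA (rm _) (rm _)) -(map_alghomM rmap_hom) tFF'.
  rewrite (map_alghom1 rmap_hom) mul1mx (mulmxA (mxstar u)) Uu mul1mx.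
  by rewrite -(map_alghomM smap_hom) F'F (map_alghom1 smap_hom).
rewrite -!mulmxA (mulmxA (sm _) (sm _)) -(map_alghomM smap_hom) FF'.
rewrite (map_alghom1 smap_hom) mul1mx (mulmxA u) uU mul1mx.
by rewrite -(map_alghomM rmap_hom) tF'F (map_alghom1 rmap_hom).
Qed.

Lemma antipode2_ubar :
  map_mx S (map_mx S (mxbar u)) = rm F^T *m mxbar u *m sm (tw Finv)^T.
Proof.
rewrite -antipode_rus -antipode2_u antipode2_bar.
by rewrite map_trmx trmxK.
Qed.

Lemma intertwiner_u :
  rm (tw Finv) *m u = map_mx S (map_mx S u) *m sm Finv.
Proof.
rewrite antipode2_u -mulmxA -(map_alghomM smap_hom) (proj1 F_inv).
by rewrite (map_alghom1 smap_hom) mulmx1.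
Qed.

(** This is (b), where K is the transpose of [tw F] and nabla^-1 K nabla is the transpose of F. *)
Lemma intertwiner_ubar :
  rm F^T *m mxbar u = map_mx S (map_mx S (mxbar u)) *m sm (tw F)^T.
Proof.
rewrite antipode2_ubar -mulmxA -(map_alghomM smap_hom).
rewrite -trmx_mul (proj1 (twist_mxinv act F_inv eF)) trmx1.
by rewrite (map_alghom1 smap_hom) mulmx1.
Qed.
End Intertwiners.

(** * Existence of an imaginary family with the prescribed values on u *)

Section Characters.
Variables (K : numClosedFieldType) (B : comStarAlgType K) (G : groupType).
Variables (act : starAction B G) (n : nat) (gam : 'I_n -> G).
Variables (F Finv : 'M[B]_n) (A : bgStarAlgType act) (u : 'M[A]_n).
Hypothesis F_inv : is_mxinv F Finv.
Hypothesis F_selfadj : mxstar F = F.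
Hypothesis eF : block_diag gam F.
Local Notation pow := (mxpowz F Finv).
Local Notation ndiag k := (nabla act gam *m iota_mx act (pow k)).
Local Notation diagn k := (iota_mx act (pow k) *m nablaV act gam).

Let ePow k : block_diag gam (pow k) := block_diag_powz k F_inv eF.

Lemma pow_commF k : F *m pow k = pow k *m F.
Proof. by rewrite -[RHS](mxpowz_succ F_inv) addrC (mxpowzD F_inv). Qed.

Lemma mxbar_ndiag k : mxbar (ndiag k) = (diagn k)^T.
Proof. by rewrite mxbar_nablaM // mxstar_powz. Qed.

(** By self-adjointness [diagn k] is the adjoint of nabla F^k, so unitarity couples the exponents k
    and -k, just as the swapped involution on pairs demands. *)
Lemma ndiag_mxinv k : is_mxinv (ndiag (- k)) (diagn k).
Proof.
have [nN Nn] := nabla_mxinv act gam.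
have [i1 i2] := mxpowzN F_inv k.
split.
  rewrite -mulmxA (mulmxA (iota_mx _ _) (iota_mx _ _)) -iota_mxM i2.
  by rewrite iota_mx1 mul1mx.
rewrite -mulmxA (mulmxA (nablaV _ _)) Nn mul1mx -iota_mxM i1.
exact: iota_mx1.
Qed.

Lemma ndiag_deg k i j : deg (gam i) (gam j) (ndiag k i j).
Proof.
rewrite nablaM_E; have [->|->] := block_diag_or i j (ePow k).
  by exists (act (gam j) (pow k i j)); rewrite eqxx.
by rewrite (alghom0 (act_hom act _)) mono0; apply: deg0.
Qed.

Lemma conj_ndiag k :
  iota_mx act (twist act gam F) *m ndiag k = ndiag k *m iota_mx act F.
Proof.
rewrite -conj_nabla_twist // /conj_nabla -!mulmxA (mulmxA (nablaV _ _)).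
by rewrite (proj2 (nabla_mxinv act gam)) mul1mx -!iota_mxM pow_commF.
Qed.

Lemma ndiag_rel k : free_unitary_rel gam F
  (pair_mx (ndiag (- k)) (ndiag k) : 'M[starsq (crossed act)]_n).
Proof.
split.
- by move=> i j; rewrite mxE; split; apply: ndiag_deg.
- rewrite /mxstar mxbar_pair !mxbar_ndiag.
  have -> (X Y : 'M[crossed act]_n) : (pair_mx X^T Y^T)^T = pair_mx X Y.
    by apply/matrixP => i j; rewrite !mxE.
  apply: pair_mx_mxinv; first exact: ndiag_mxinv.
  by rewrite -{1}[k]opprK; apply: ndiag_mxinv.
(* The inverse of the conjugate is the transpose of the pair itself, so the remaining relation says
   that F commutes with its powers. *)
- exists (pair_mx (ndiag (- k))^T (ndiag k)^T).
    rewrite mxbar_pair !mxbar_ndiag; apply: pair_mx_mxinv.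
      by apply: nabla_tr_mxinv => //; apply: mxpowzN.
    by apply: nabla_tr_mxinv => //; rewrite -{2}[k]opprK; apply: mxpowzN.
rewrite (MnB_conj_nabla act eF).
transitivity (pair_mx (iota_mx act (twist act gam F) *m ndiag (- k))
                      (iota_mx act (twist act gam F) *m ndiag k)).
  rewrite -pair_mxM; congr (_ *m _); apply/matrixP => i j.
    by rewrite [LHS]mxE [RHS]mxE ![iota_mx _ _ _ _]mxE.
  by rewrite [LHS]mxE [LHS]mxE [RHS]mxE ![(_^T)%R _ _]mxE.
rewrite !conj_ndiag -pair_mxM; congr (_ *m _); apply/matrixP => i j.
by rewrite [LHS]mxE [RHS]mxE ![iota_mx _ _ _ _]mxE.
Qed.

Hypothesis A_free : is_free_unitary gam F u.

Lemma imaginary_characters : exists theta : int -> bgMor A (crossed act),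
  imaginary theta /\ forall k, map_mx (theta k) u = ndiag (- k).
Proof.
have [_ univ] := A_free.
pose v k : 'M[starsq (crossed act)]_n := pair_mx (ndiag (- k)) (ndiag k).
have /boolp.choice[h hP] k : exists h : bgMor A (starsq (crossed act)),
    star_preserving h /\ map_mx h u = v k.
  by have [h [hs hu _]] := univ _ _ (ndiag_rel k); exists h.
exists (fun k => compmor (starsq_fst (crossed act)) (h k)).
have hu k : map_mx (compmor (starsq_fst (crossed act)) (h k)) u = ndiag (- k).
  apply/matrixP => i j; have [_ /matrixP/(_ i j)] := hP k.
  by rewrite !mxE /= => ->.
split=> // k a.
rewrite /= (proj1 (hP k)).
(* The swapped involution has turned [theta k (star a)] into the star of the second component of
   [h k a]. That component and the first component of [h (- k)] both send u to nabla F^k, hence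
   agree. *)
congr star; apply: (free_unitary_ext
  (f := compmor (starsq_snd (crossed act)) (h k))
  (g := compmor (starsq_fst (crossed act)) (h (- k))) A_free).
apply/matrixP => i j; rewrite hu opprK; have [_ /matrixP/(_ i j)] := hP k.
by rewrite !mxE /= => ->.
Qed.
End Characters.

(** * The character group axioms and the scaling property, compared on u *)

Section CharacterGroup.
Variables (K : numClosedFieldType) (B : comStarAlgType K) (G : groupType).
Variables (act : starAction B G) (n : nat) (gam : 'I_n -> G).
Variables (F Finv : 'M[B]_n) (A : bgStarAlgType act) (u : 'M[A]_n).
Variables (H : hopfAlgebroid A) (theta : int -> bgMor A (crossed act)).
Hypothesis F_inv : is_mxinv F Finv.
Hypothesis F_selfadj : mxstar F = F.
Hypothesis eF : block_diag gam F.
Hypothesis A_free : is_free_unitary gam F u.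
Hypothesis H_fund : is_fundamental_hopf gam u H.
Local Notation pow := (mxpowz F Finv).
Local Notation ndiag k := (nabla act gam *m iota_mx act (pow k)).
Hypothesis theta_im : imaginary theta.
Hypothesis theta_u : forall k, map_mx (theta k) u = ndiag (- k).

Let u_rel : free_unitary_rel gam F u := proj1 A_free.
Let du i j : deg (gam i) (gam j) (u i j).
Proof. by case: u_rel. Qed.
Let ePow k : block_diag gam (pow k) := block_diag_powz k F_inv eF.

Lemma theta_uE k i j : theta k (u i j) =
  mono act (gam i) (act (gam i) (pow (- k) i j)).
Proof. by have /matrixP/(_ i j) := theta_u k; rewrite nablaM_E mxE. Qed.

(** As theta is imaginary, the value is the entrywise adjoint of theta^(-k)(u) = nabla F^k. *)
Lemma theta_ubar k :
  map_mx (theta k) (mxbar u) = (iota_mx act (pow k))^T *m nablaV act gam.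
Proof.
rewrite -tr_iota_nablaV // -mxbar_ndiag // -[k in ndiag k]opprK -theta_u.
by apply/matrixP => i j; rewrite !mxE theta_im.
Qed.

Lemma theta_comult k l a :
  lunit (crossed act) (fmor (theta k) (theta l) (comult H a)) = theta (k + l) a.
Proof.
have [_ H_comult _ _] := H_fund.
apply: (free_unitary_ext (f := compmor (lunit (crossed act))
  (compmor (fmor (theta k) (theta l)) (comult H))) A_free).
apply/matrixP => i j; rewrite [LHS]mxE [RHS]mxE theta_uE.
transitivity (\sum_m mono act (gam i)
                 (act (gam i) (pow (- k) i m * pow (- l) m j))).
  rewrite -[LHS]/(lunit _ (fmor (theta k) (theta l) (comult H (u i j)))) H_comult.
  rewrite (alghom_sum (mor_hom (fmor (theta k) (theta l)))).
  rewrite (alghom_sum (mor_hom (lunit _))); apply: eq_bigr => m _.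
  have fu := fib_deg (du i m) (du m j).
  rewrite fmor_tens // lunit_tens; last exact: (fib_pmor _ _ fu).
  rewrite !theta_uE rhat_mono [LHS]monoM mul1g act_1 (alghomM (act_hom act _)).
  (* [rhat] has dropped the group element gam_i; the surviving gam_m equals it unless the entry of
     F^-k vanishes. *)
  have [->//|->] := block_diag_or i m (ePow (- k)).
  by rewrite (alghom0 (act_hom act _)) !mul0r !mono0.
rewrite opprD (mxpowzD F_inv) mxE (alghom_sum (act_hom act _)).
by rewrite (big_morph _ (@monoD _ _ _ act (gam i)) (@mono0 _ _ _ act (gam i))).
Qed.

Lemma theta_counit a : theta 0 a = counit H a.
Proof.
have [_ _ H_counit _] := H_fund.
apply: (free_unitary_ext A_free); apply/matrixP => i j.
rewrite [LHS]mxE [RHS]mxE H_counit theta_uE oppr0 mxE.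
case: eqP => _; first by rewrite (alghom1 (act_hom act _)).
by rewrite (alghom0 (act_hom act _)) mono0.
Qed.

(** On generators S(u_ij) is the adjoint of u_ji, so imaginarity brings both sides to powers of F
    with exponent k, and the claim becomes the self-adjointness of F^k. *)
Lemma theta_antipode k a : theta k (antipode H a) = crantip (theta (- k) a).
Proof.
have [_ _ _ Su_inv] := H_fund.
apply: (free_unitary_ext (f := compmor (coop_mor (theta k)) (antipode_mor H))
  (g := compmor (crantip_mor act) (theta (- k))) A_free).
apply/matrixP => i j; rewrite [LHS]mxE [RHS]mxE.
transitivity (theta k (star (u j i))).
  have /matrixP/(_ i j) := antipode_u u_rel Su_inv; rewrite !mxE => e.
  exact: congr1 _ e.
rewrite theta_im -[RHS]/(crantip (theta (- k) (u i j))) !theta_uE opprK.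
rewrite [LHS]crstarE [RHS]crantipE act_star -!act_mul !mulVg !act_1.
rewrite -{2}(mxstar_powz k F_inv F_selfadj) !mxE.
by have [->//|->] := block_diag_or j i (ePow k); rewrite star0 !mono0.
Qed.

Lemma theta_character_group : character_group H theta.
Proof.
split; [exact: theta_comult|exact: theta_counit|exact: theta_antipode].
Qed.

(** On u, theta^(1) on the left contributes r(nabla F^-1 nabla^-1) and theta^(-1) on the right
    contributes s(F), which together is the formula for S^2(u). *)
Lemma theta_scaling : scaling H theta.
Proof.
move=> a; have [_ H_comult _ Su_inv] := H_fund.
pose T1 := fmor (comult H) (idmor A).
pose T2 := fmor (fmor (theta 1) (idmor A)) (theta (- 1)).
pose T3 := fmor (lunit A) (idmor (crossed act)).
apply: (free_unitary_ext (f := antipode2 H)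
  (g := compmor (runit A) (compmor T3 (compmor T2 (compmor T1 (comult H)))))
  A_free).
have lE i l : lunit A (fmor (theta 1) (idmor A) (comult H (u i l)))
    = \sum_k rmap (twist act gam Finv i k) * u k l.
  rewrite H_comult (alghom_sum (mor_hom (fmor _ _))).
  rewrite (alghom_sum (mor_hom (lunit _))); apply: eq_bigr => k _.
  have fu := fib_deg (du i k) (du k l).
  rewrite fmor_tens // lunit_tens; last exact: (fib_pmor _ _ fu).
  by rewrite theta_uE rhat_mono mxE.
apply/matrixP => i j.
have /matrixP/(_ i j) := antipode2_u F_inv eF u_rel Su_inv.
rewrite mxE [_ (map_mx _ _) i j]mxE => S2; rewrite [LHS]mxE [LHS]S2.
rewrite [RHS]mxE -[RHS]/(runit A (T3 (T2 (T1 (comult H (u i j)))))) H_comult.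
rewrite (alghom_sum (mor_hom T1)) (alghom_sum (mor_hom T2)).
rewrite (alghom_sum (mor_hom T3)) (alghom_sum (mor_hom (runit A))) mxE.
apply: eq_bigr => l _.
(* The maps are evaluated on elementary tensors satisfying [fib], so this condition is carried
   through each stage. *)
have f0 := fib_deg (du i l) (du l j).
have f1 := fib_pmor (comult H) (idmor A) f0.
have f2 := fib_pmor (fmor (theta 1) (idmor A)) (theta (- 1)) f1.
have f3 := fib_pmor (lunit A) (idmor (crossed act)) f2.
rewrite /T1 /T2 /T3 (fmor_tens _ _ f0) (fmor_tens _ _ f1) (fmor_tens _ _ f2).
rewrite (runit_tens f3) -[RHS]/(shat A (theta (- 1) (u l j))
  * lunit A (fmor (theta 1) (idmor A) (comult H (u i l)))).
rewrite lE theta_uE shat_mono opprK.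
rewrite mxE mulr_suml mulr_sumr; apply: eq_bigr => k _.
rewrite [map_mx rmap _ _ _]mxE [map_mx smap _ _ _]mxE.
(* [runit] puts s(gam_l(f_lj)) in front; this is what s(f_lj) becomes when moved left past u_kl, of
   degree (gam_k, gam_l). *)
by rewrite -mulrA (smap_act _ _ _ _ (du k l)) [LHS]mulrA rsmapC -mulrA.
Qed.
End CharacterGroup.

Theorem proposition2p5p4 (R : realType) (B : comStarAlgType R[i])
    (G : groupType) (act : starAction B G) (n : nat) (gam : 'I_n -> G)
    (F Finv : 'M[B]_n) (F_inv : is_mxinv F Finv) (F_selfadj : mxstar F = F)
    (F_even : nabla_even act gam F)
    (A : bgStarAlgType act) (u : 'M[A]_n)
    (A_free : is_free_unitary gam F u)
    (H : hopfAlgebroid A) (H_fund : is_fundamental_hopf gam u H) :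
  [/\ (* (a) *)
      in_MnB (conj_nabla act gam Finv) /\
      map_mx rmap (MnB (conj_nabla act gam Finv)) *m u
        = map_mx (antipode H) (map_mx (antipode H) u) *m map_mx smap Finv,
      (* (b) *)
      let K := (MnB (conj_nabla act gam F))^T in
      let K' := nablaV act gam *m iota_mx act K *m nabla act gam in
      in_MnB K' /\
      map_mx rmap (MnB K') *m mxbar u
        = map_mx (antipode H) (map_mx (antipode H) (mxbar u)) *m map_mx smap K
    & (* (c) *)
      exists theta : int -> bgMor A (crossed act),
        [/\ character_group H theta, scaling H theta, imaginary theta,
            forall k : int, map_mx (theta k) u
              = nabla act gam *m iota_mx act (mxpowz F Finv (- k))
          & forall k : int, map_mx (theta k) (mxbar u)
              = (iota_mx act (mxpowz F Finv k))^T *m nablaV act gam]].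
Proof.
have eF := nabla_evenP F_even.
have eFinv := block_diag_inv F_inv eF.
have u_rel := proj1 A_free.
have [_ _ _ Su_inv] := H_fund.
split.
- rewrite (MnB_conj_nabla act eFinv); split.
    by exists (twist act gam Finv); apply: conj_nabla_twist.
  exact: intertwiner_u F_inv eF u_rel Su_inv.
- move=> K K'.
  (* K has entries gam_j(f_ji); conjugating back by nabla undoes this twist because gam_i = gam_j
     unless f_ji = 0. *)
  have eK' : K' = iota_mx act F^T.
    rewrite /K' /K (MnB_conj_nabla act eF).
    apply/matrixP => i j; rewrite mul_mx_diag mxE mul_diag_mx !mxE !monoM.
    rewrite mul1r mulg1 (alghom1 (act_hom act _)) mulr1 -act_mul.
    have [->|->] := block_diag_or j i eF; first by rewrite mulVg act_1.
    by rewrite (alghom0 (act_hom act _)) /Defs.iota !mono0.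
  rewrite eK' iota_mxK; split; first by exists F^T.
  rewrite /K (MnB_conj_nabla act eF).
  exact: intertwiner_ubar F_inv eF u_rel Su_inv.
have [theta [theta_im theta_u]] := imaginary_characters F_inv F_selfadj eF A_free.
exists theta; split=> //.
- exact: theta_character_group theta_u.
- exact: theta_scaling theta_u.
- exact: theta_ubar theta_u.
Qed.
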